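(* Let $G$ be a finite group with a split $BN$-pair of characteristic $p$ satisfying the commutator relations, and let $K$ be an algebraically closed field of characteristic $\ell\ge0$ with $\ell\neq p$. Let $M$ be an irreducible $KG$-module which is imprimitive with block stabilizer $P$, where $P$ is a parabolic subgroup of $G$. Then $M\cong R_L^G(M_1)$ for some $KL$-module $M_1$, where $L$ is a Levi complement in $P$. In other words, $M$ is Harish-Chandra induced.
   Context: A $KG$-module $M$ is imprimitive with block stabilizer $P$ if $P$ is a proper subgroup of $G$ and $M\cong\mathrm{Ind}_P^G(M_2)$ for some $KP$-module $M_2$ (no condition on the action of the unipotent radical of $P$ on $M_2$). A parabolic (resp. Levi) subgroup of $G$ is an $N$-conjugate of a standard parabolic (resp. standard Levi) subgroup. For a Levi subgroup $L$ and a $KL$-module $M_1$, Harish-Chandra induction is $R_L^G(M_1)=\mathrm{Ind}_P^G(\tilde M_1)$, where $P$ is a parabolic subgroup of $G$ with Levi complement $L$ and $\tilde M_1$ is the inflation of $M_1$ to $P$; up to isomorphism this is independent of the choice of $P$ with Levi complement $L$. *)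

(* Defs.v *)
From HB Require Import structures.
From mathcomp Require Import all_boot all_order all_algebra all_fingroup.
From mathcomp Require Import all_solvable mxrepresentation.
From mathcomp Require Import boolp reals trigo.

Set Implicit Arguments.
Unset Strict Implicit.
Unset Printing Implicit Defensive.

Import Order.TTheory GRing.Theory Num.Theory.
Local Open Scope group_scope.

(* Modules are mathcomp's matrix representations, i.e. right modules: group
   elements act on row vectors by right multiplication. *)
Section Modules.

Variables (K : fieldType) (gT : finGroupType).

Section Induction.

Variables (G H : {group gT}) (sHG : H \subset G).
Variables (n : nat) (rH : mx_representation K H n).

Definition rcoset_rep (i : 'I_#|G : H|) : gT := repr (enum_val i).

(* The matrix of x on (M (x)_KH KG) in the basis (e_a (x) t_i), where the t_i
   represent the right cosets H t_i: if t_i x = h t_j with h \in H, then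
   (v (x) t_i) x = v h (x) t_j. *)
Definition induced_mx (x : gT) : 'M[K]_(\sum_(i < #|G : H|) n) :=
  \mxblock_(i < #|G : H|, j < #|G : H|)
    (let h := rcoset_rep i * x * (rcoset_rep j)^-1 in
     if h \in H then rH h else 0%R).

Lemma rcoset_repP i : rcoset_rep i \in G /\ enum_val i = H :* rcoset_rep i.
Proof.
have /rcosetsP[x Gx Ex] := enum_valP i; rewrite /rcoset_rep Ex.
have xr : repr (H :* x) \in H :* x by apply: mem_repr (rcoset_refl H x).
split; last exact/esym/rcoset_eqP.
by case/rcosetP: xr => h Hh ->; rewrite groupM // (subsetP sHG).
Qed.

Lemma rcoset_rep_inj i j :
  (rcoset_rep i * (rcoset_rep j)^-1 \in H) = (i == j).
Proof.
rewrite -mem_rcoset; apply/idP/eqP => [|->]; last exact: rcoset_refl.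
move/rcoset_eqP => E; apply: enum_val_inj.
by rewrite (rcoset_repP i).2 (rcoset_repP j).2.
Qed.

Lemma rcoset_rep_ex x : x \in G -> exists j, x * (rcoset_rep j)^-1 \in H.
Proof.
move=> Gx; have Hx : H :* x \in rcosets H G by apply/rcosetsP; exists x.
exists (enum_rank_in Hx (H :* x)).
rewrite -mem_rcoset -(rcoset_repP _).2 enum_rankK_in //.
exact: rcoset_refl.
Qed.

Lemma induced_mx_repr : mx_repr G induced_mx.
Proof.
split=> [|x y Gx Gy].
  rewrite -mxdiagZ /mxdiag; apply/eq_mxblock=> i j /=.
  rewrite mulg1 rcoset_rep_inj; case: eqVneq => [<-|//].
  by rewrite mulgV repr_mx1 conform_mx_id.
rewrite /induced_mx mul_mxblock; apply/eq_mxblock=> i j /=.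
have [k Hk] := rcoset_rep_ex (groupM (rcoset_repP i).1 Gx).
rewrite (bigD1 k) //= Hk big1 ?addr0 => [|k' nk]; last first.
  case: ifP => Hk'; last by rewrite mul0mx.
  case/negP: nk; rewrite -rcoset_rep_inj.
  by rewrite -(groupMl _ Hk') mulgA mulgKV.
set a := _ * x * _ in Hk *.
have -> : rcoset_rep i * (x * y) * (rcoset_rep j)^-1
          = a * (rcoset_rep k * y * (rcoset_rep j)^-1).
  by rewrite /a !mulgA mulgKV.
rewrite groupMl //; case: ifP => Hy; last by rewrite mulmx0.
exact: repr_mxM.
Qed.

Definition Ind : mx_representation K G _ := MxRepresentation induced_mx_repr.

End Induction.

Section Inflation.

Variables (P U L : {group gT}) (defP : U ><| L = P).
Variables (n : nat) (rL : mx_representation K L n).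

(* remgr U L (u * l) = l for u \in U and l \in L *)
Definition inflation_mx (x : gT) : 'M[K]_n := rL (remgr U L x).

Lemma inflation_mx_repr : mx_repr P inflation_mx.
Proof.
have [_ defUL _ tiUL] := sdprodP defP.
split=> [|x y Px Py]; first by rewrite /inflation_mx remgr1 ?group1 ?repr_mx1.
have LP z : z \in P -> remgr U L z \in L by rewrite -defUL; apply: mem_remgr.
rewrite /inflation_mx -repr_mxM ?LP //; congr (rL _).
have nUP : U <| P by case: (sdprod_context defP).
by apply: (remgrM _ nUP) => //; apply/complP.
Qed.

Definition inflation : mx_representation K P n :=
  MxRepresentation inflation_mx_repr.

End Inflation.

Definition imprimitive_with_block_stabilizer (G P : {group gT})
    (sPG : P \subset G) (n : nat) (rG : mx_representation K G n) : Prop :=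
  (P != G :> {set gT}) /\
  exists (n2 : nat) (rP : mx_representation K P n2), mx_rsim rG (Ind sPG rP).

(* The parabolic subgroup P used to form R_L^G is part of the data, through
   the Levi decomposition of P; U is the unipotent radical of P, i.e. 'O_p(P)
   when P is a parabolic subgroup in characteristic p. *)
Definition HC_induction (G P U L : {group gT}) (sPG : P \subset G)
    (defP : U ><| L = P) (m : nat) (rL : mx_representation K L m) :
    mx_representation K G _ :=
  Ind sPG (inflation defP rL).

End Modules.

Section BNPairs.

Variables (gT : finGroupType) (G B N : {group gT}).

Local Notation H := (B :&: N)%G.

Variables (r : nat) (s : 'I_r -> coset_of H).

(* The Weyl group is N / H, and the s i are its distinguished generators. *)
Record BN_pair : Prop := {
  BN_gen : B <*> N = G;
  BN_normal : H <| N;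
  BN_weyl_gen : <<[set s i | i : 'I_r]>> = N / H;
  BN_distinct : injective s;
  BN_invol : forall i, s i ^+ 2 = 1;
  BN_mul : forall i ni n, ni \in N -> coset H ni = s i -> n \in N ->
    [set ni] * B * [set n] \subset (B * [set ni * n] * B) :|: (B * [set n] * B);
  BN_neq : forall i ni, ni \in N -> coset H ni = s i -> B :^ ni != B
}.

Record split_BN_pair (p : nat) (U : {group gT}) : Prop := {
  split_BN : BN_pair;
  split_p_prime : prime p;
  split_B : U ><| H = B;
  split_U : p.-group U;
  split_H : p^'.-group H;
  split_abelian : abelian H;
  split_saturated : \bigcap_(n in N) (B :^ n) = H
}.

Definition word_elt (w : seq 'I_r) : coset_of H := \prod_(i <- w) s i.

(* The default value of find, #|N / H|, is never reached on N / H. *)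
Definition weyl_length (w : coset_of H) : nat :=
  find (fun k => [exists t : k.-tuple 'I_r, word_elt t == w])
       (iota 0 #|N / H|).

Definition longest_elt : coset_of H :=
  [arg max_(w > 1 in N / H) weyl_length w].

(* Conjugating U by a coset of H does not depend on the representative, since
   H normalises U. *)
Definition simple_root_subgroup (U : {group gT}) (i : 'I_r) : {set gT} :=
  U :&: U :^ repr (longest_elt * s i).

Section RootSystem.

Variable R : realType.

Local Open Scope ring_scope.

(* The geometric representation of (W, S) on R^r, with basis the simple roots:
   (alpha_i, alpha_j) = - cos (pi / m_ij), where m_ij is the order of
   s_i s_j. *)
Definition gram : 'M[R]_r :=
  \matrix_(i, j) - cos (pi / #[(s i * s j)%g]%:R).

Definition simple_root (i : 'I_r) : 'rV[R]_r := delta_mx 0 i.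

Definition simple_reflection (i : 'I_r) (v : 'rV[R]_r) : 'rV[R]_r :=
  v - (2 * (v *m gram) 0 i) *: simple_root i.

(* s_(i_1) (s_(i_2) (... v)) for the word w = i_1 i_2 ... *)
Definition word_act (w : seq 'I_r) (v : 'rV[R]_r) : 'rV[R]_r :=
  foldr simple_reflection v w.

(* X is the root subgroup X_alpha, where alpha = w(alpha_i) and
   X_alpha = n X_i n^-1 for n \in N mapping to w; recall that
   A :^ x = x^-1 A x. *)
Definition root_subgroup (U : {group gT}) (alpha : 'rV[R]_r) (X : {set gT}) :
    Prop :=
  exists (w : seq 'I_r) (i : 'I_r) (n : gT),
    [/\ n \in N, coset H n = word_elt w, alpha = word_act w (simple_root i)
      & X = (simple_root_subgroup U i :^ n^-1)%g].

(* Positive real (rather than integral) combinations, as the Weyl group need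
   not be crystallographic. *)
Definition positive_combination (alpha beta gamma : 'rV[R]_r) : Prop :=
  exists a b : R, [/\ 0 < a, 0 < b & gamma = a *: alpha + b *: beta].

(* Roots have norm 1 here, so that two roots are linearly dependent if and
   only if they are equal or opposite. *)
Definition commutator_relations (U : {group gT}) : Prop :=
  forall (alpha beta : 'rV[R]_r) (X Y : {set gT}),
    root_subgroup U alpha X -> root_subgroup U beta Y ->
    alpha <> beta -> alpha <> - beta ->
    ([~: X, Y] \subset
       <<[set x | `[< exists (gamma : 'rV[R]_r) (Z : {set gT}),
                     [/\ positive_combination alpha beta gamma,
                         root_subgroup U gamma Z & x \in Z] >]]>>)%g.

End RootSystem.

(* The preimage N_J in N of the subgroup W_J of N / H generated by the s j. *)
Definition parabolic_N (J : {set 'I_r}) : {group gT} :=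
  (coset H @*^-1 <<[set s j | j in J]>>)%G.

Definition standard_parabolic (J : {set 'I_r}) : {set gT} :=
  B * parabolic_N J * B.

(* Generated by H and the X_alpha, for alpha in the W_J-orbits of the simple
   roots indexed by J. *)
Definition standard_Levi (U : {group gT}) (J : {set 'I_r}) : {set gT} :=
  <<H :|: \bigcup_(j in J) \bigcup_(n in parabolic_N J)
            simple_root_subgroup U j :^ n>>.

Definition is_parabolic (P : {group gT}) : Prop :=
  exists (J : {set 'I_r}) (n : gT),
    n \in N /\ P = standard_parabolic J :^ n :> {set gT}.

(* The same J and n serve for P and L. That L is a complement to 'O_p(P) in P
   is a theorem (the Levi decomposition), not part of the definition. *)
Definition Levi_complement (U P L : {group gT}) : Prop :=
  exists (J : {set 'I_r}) (n : gT),
    [/\ n \in N, P = standard_parabolic J :^ n :> {set gT}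
      & L = standard_Levi U J :^ n :> {set gT}].

End BNPairs.

(* Main.v *)
Require Import Defs.
From mathcomp Require Import all_boot all_order all_algebra all_fingroup.
From mathcomp Require Import all_solvable mxrepresentation.
From mathcomp Require Import boolp reals trigo ring.

(* Let P = A L with A = O_p(P), and let Q = V L be the opposite parabolic
   subgroup, so that P and Q have the same order and meet in L.  If
   M = Ind_P^G M_2 is irreducible, the double coset P Q gives a nonzero map from
   M to Ind_Q^G of the inflation of Res_L M_2.  Both modules have the same
   dimension, so this map is an isomorphism.  Repeating the argument with Q and P
   exchanged brings the induction back to P, now from an inflated module.

   For the Levi decomposition, let height be the sum of the coefficients of a
   root outside J.  The group A (resp. V) generated by the root subgroups of
   positive (resp. negative) height is normalised by L, by the commutator
   relations and because W_J preserves the height.  Factoring U along a reduced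
   word of w0 that ends with a longest word of W_J gives U <= A L, and in the same
   way U^w0 <= V L.  Now the Sylow p-subgroup U^w0 forces A to meet N(V)
   trivially; hence A meets L trivially, and L contains N_J.  That roots of
   nonzero height have their root subgroups in U or in U^w0 rests on the
   positivity theorem for the geometric representation of the Weyl group. *)

(** Passing through Q remembers only the restriction of M_2 to L, which is how the unknown action of
    A disappears. No unique factorisation of U into root subgroups is given, so A and L cannot be
    seen to meet trivially by comparing roots; the Sylow argument replaces this. Roots are vectors,
    tied to subgroups only through words in the generators, and the BN axioms do not include a
    Coxeter presentation of W. To speak of the sign of a root, one therefore derives the exchange
    condition from products of Bruhat cells, shows that words with the same product act equally on
    R^r, and only then proves positivity. *)

Set Implicit Arguments.
Unset Strict Implicit.
Unset Printing Implicit Defensive.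

Import Order.TTheory GRing.Theory Num.Theory.
Local Open Scope group_scope.

(** * Exchanging a parabolic subgroup for an opposite one in an induced module *)

Section OppositeInduction.

Variables (K : fieldType) (gT : finGroupType) (G P Q V L : {group gT}).
Hypotheses (sPG : P \subset G) (sQG : Q \subset G) (sLP : L \subset P).
Hypotheses (defQ : V ><| L = Q) (tiPV : P :&: V = 1) (cardPQ : #|P| = #|Q|).
Variables (m : nat) (rP : mx_representation K P m).

Let rQ : mx_representation K Q m := inflation defQ (subg_repr rP sLP).

(** The support [P * V] is the double coset P Q, since Q = L V and L lies in P; factors in [P * V]
    are unique because P and V meet trivially. *)
Let kernel (x : gT) : 'M[K]_m :=
  if x \in P * V then rP (divgr P V x) else 0%R.

Let divgrMid (a v : gT) : a \in P -> v \in V -> divgr P V (a * v) = a.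
Proof. by move=> Pa Vv; rewrite /divgr remgrMid // mulgK. Qed.

Let kernelMid (a v : gT) : a \in P -> v \in V -> kernel (a * v) = rP a.
Proof. by move=> Pa Vv; rewrite /kernel mem_mulg // divgrMid. Qed.

Let kernel_out (x : gT) : x \notin P * V -> kernel x = 0%R.
Proof. by rewrite /kernel => /negPf->. Qed.

Let kernelMl (a x : gT) : a \in P -> kernel (a * x) = (rP a *m kernel x)%R.
Proof.
move=> Pa; have [/mulsgP[b v Pb Vv ->]|nx] := boolP (x \in P * V).
  by rewrite mulgA !kernelMid ?groupM // repr_mxM.
rewrite (kernel_out nx) mulmx0 kernel_out //; apply: contra nx.
case/mulsgP=> b v Pb Vv /(canRL (mulKg a)) ->; rewrite mulgA.
by rewrite mem_mulg ?groupM ?groupV.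
Qed.

(** L normalises V, so y = l w takes b v to (b l)(v^l w), while [rQ] sees only l. *)
Let kernelMr (x y : gT) : y \in Q -> kernel (x * y) = (kernel x *m rQ y)%R.
Proof.
move=> Qy; have [_ defVL nVL tiVL] := sdprodP defQ.
have defLV : L * V = Q by rewrite (normC nVL).
have step z b v l w : z = b * v -> b \in P -> v \in V ->
    l \in L -> w \in V -> y = l * w -> z * y = (b * l) * (v ^ l * w).
  by move=> -> _ _ _ _ ->; rewrite conjgE !mulgA !mulgK.
have /mulsgP[l w Ll Vw Dy] : y \in L * V by rewrite defLV.
have nVl : l \in 'N(V) by apply: subsetP nVL _ Ll.
have Ey : rQ y = rP l.
  rewrite -[LHS]/(rP (remgr V L y)); congr (rP _).
  have -> : y = w ^ l^-1 * l by rewrite Dy conjgE invgK !mulgA mulgKV.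
  by rewrite (remgrMid tiVL) ?memJ_norm ?groupV.
have Pl : l \in P := subsetP sLP l Ll.
have [/mulsgP[b v Pb Vv Dx]|nx] := boolP (x \in P * V).
  have Vvl : v ^ l \in V by rewrite memJ_norm.
  rewrite (step _ _ _ _ _ Dx Pb Vv Ll Vw Dy) Dx Ey.
  by rewrite !kernelMid ?repr_mxM // groupM.
rewrite (kernel_out nx) mul0mx kernel_out //; apply: contra nx.
case/mulsgP=> b v Pb Vv Dxy.
have -> : x = (b * l^-1) * (v * w^-1) ^ l^-1.
  by rewrite conjgE invgK !mulgA mulgKV -Dxy Dy !mulgA !mulgK.
by rewrite mem_mulg ?memJ_norm ?groupV // groupM ?groupV.
Qed.

(* The blocks implement the map supported on the double coset P Q; by
   Mackey's formula it is a component of Hom(Ind_P rP, Ind_Q rQ). *)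
Let opposite_mx : 'M[K]_(\sum_(i < #|G : P|) m, \sum_(j < #|G : Q|) m) :=
  \mxblock_(i < #|G : P|, j < #|G : Q|)
    kernel (@rcoset_rep gT G P i * (@rcoset_rep gT G Q j)^-1).

Let opposite_mx_hom x : x \in G ->
  (Ind sPG rP x *m opposite_mx = opposite_mx *m Ind sQG rQ x)%R.
Proof.
move=> Gx; rewrite /= /induced_mx /opposite_mx !mul_mxblock.
apply/eq_mxblock=> i j; set t := rcoset_rep i; set u := rcoset_rep j.
have [Gt _] := rcoset_repP sPG i; have [Gu _] := rcoset_repP sQG j.
(* Both products have this (i, j) block: a single coset contributes to each sum, by [kernelMl] for
   the first and [kernelMr] for the second. *)
transitivity (kernel (t * x * u^-1)).
  have [k Pk] := rcoset_rep_ex sPG (groupM Gt Gx).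
  rewrite (bigD1 k) //= Pk -kernelMl // !mulgA mulgKV big1 ?addr0 //.
  move=> k' nk; case: ifP => Pk'; last by rewrite mul0mx.
  case/negP: nk; rewrite -(rcoset_rep_inj sPG).
  by rewrite -(groupMl _ Pk') mulgA mulgKV.
have [k Qk] := rcoset_rep_ex sQG (groupM Gu (groupVr Gx)).
have Qk' : rcoset_rep k * x * u^-1 \in Q.
  by rewrite -groupV !invMg !invgK mulgA.
rewrite (bigD1 k) //= Qk' -kernelMr // !mulgA mulgKV big1 ?addr0 //.
move=> k' nk; case: ifP => Q2; last by rewrite mulmx0.
case/negP: nk; rewrite -(rcoset_rep_inj sQG).
have -> : rcoset_rep k' * (rcoset_rep k)^-1
   = rcoset_rep k' * x * u^-1 * (rcoset_rep k * x * u^-1)^-1.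
  by rewrite !invMg !invgK !mulgA !mulgKV mulgK.
by rewrite groupM ?groupV.
Qed.

(** The block at the trivial cosets of P and Q is a product of two representation matrices, hence
    invertible. *)
Let opposite_mx_neq0 : (0 < m)%N -> opposite_mx != 0%R.
Proof.
move=> m0; have [i Pi] := rcoset_rep_ex sPG (group1 G).
have [j Qj] := rcoset_rep_ex sQG (group1 G).
rewrite mul1g groupV in Pi; rewrite mul1g in Qj.
apply: contraTneq m0 => A0; rewrite -leqNgt leqn0.
have := mxblockK (fun (i : 'I_#|G : P|) (j : 'I_#|G : Q|) =>
  kernel (@rcoset_rep gT G P i * (@rcoset_rep gT G Q j)^-1)) i j.
have k1 : kernel 1 = 1%:M%R.
  by have := kernelMid (group1 P) (group1 V); rewrite mulg1 repr_mx1.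
have kQ y : y \in Q -> kernel y = rQ y.
  by move=> Qy; rewrite -(mul1g y) kernelMr // k1 mul1mx mul1g.
rewrite -/opposite_mx A0 kernelMl // kQ // => E.
have: (rP (rcoset_rep i) *m rQ (rcoset_rep j)^-1%g)%R \in unitmx.
  by rewrite unitmx_mul !repr_mx_unit.
rewrite -E (_ : submxblock _ _ _ = 0%R).
  by rewrite -row_free_unit /row_free mxrank0 eq_sym.
by apply/matrixP=> a b; rewrite !mxE.
Qed.

Lemma Ind_opposite n (M : mx_representation K G n) :
    mx_irreducible M -> mx_rsim M (Ind sPG rP) ->
  mx_rsim M (Ind sQG rQ).
Proof.
move=> irrM [A Dn freeA homA].
have Ed : (\sum_(i < #|G : P|) m = \sum_(i < #|G : Q|) m)%N.
  by rewrite !sum_nat_const !card_ord -!divgS // cardPQ.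
have n0 : (0 < n)%N.
  by have [_ nz _] := irrM; rewrite lt0n -(mxrank1 K n) mxrank_eq0.
have m0 : (0 < m)%N.
  by case: posnP => // m0; rewrite Dn m0 big1 in n0.
have homC x : x \in G ->
    (M x *m (A *m opposite_mx) = A *m opposite_mx *m Ind sQG rQ x)%R.
  by move=> Gx; rewrite mulmxA homA // -!mulmxA opposite_mx_hom.
apply: (@MxReprSim _ _ _ _ _ _ _ (A *m opposite_mx)%R); rewrite ?Dn //.
(* The kernel is a submodule of M. Were it nonzero, it would be all of M, and cancelling the square
   invertible [A] would give [opposite_mx] = 0. *)
rewrite -kermx_eq0; apply: contraTT isT => ker_n0.
have [_ _ minM] := irrM.
have: (1%:M%R <= kermx (A *m opposite_mx))%MS.
  apply: minM; rewrite ?submx1 //; apply/mxmoduleP=> x Gx.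
  by apply/sub_kermxP; rewrite -mulmxA homC // mulmxA mulmx_ker mul0mx.
rewrite sub_kermx mul1mx => /eqP C0; case/negP: (opposite_mx_neq0 m0).
have fullA : row_full A.
  by rewrite /row_full (eqP freeA) -{1}Dn.
by rewrite -(mul1mx opposite_mx) -(mulVpmx fullA) -mulmxA C0 mulmx0.
Qed.

End OppositeInduction.

(** * Words, Bruhat cells and the exchange condition *)

Section WeylGroup.

Variables (gT : finGroupType) (G B N : {group gT}) (r : nat).
Variable s : 'I_r -> coset_of (B :&: N)%G.
Hypothesis BN : BN_pair G s.

Local Notation H := (B :&: N)%G.
Local Notation W := (N / H).
Local Notation l := (weyl_length s).
Local Notation we := (word_elt s).

Lemma word_elt_cat t1 t2 : we (t1 ++ t2) = we t1 * we t2.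
Proof. exact: big_cat. Qed.

Lemma word_elt_cons i t : we (i :: t) = s i * we t.
Proof. exact: big_cons. Qed.

Lemma word_elt1 i : we [:: i] = s i.
Proof. exact: big_seq1. Qed.

Lemma word_elt_rcons t i : we (rcons t i) = we t * s i.
Proof. by rewrite -cats1 word_elt_cat word_elt1. Qed.

Lemma word_elt_nil : we [::] = 1.
Proof. exact: big_nil. Qed.

Lemma mem_simple i : s i \in W.
Proof. by rewrite -(BN_weyl_gen BN) mem_gen ?imset_f. Qed.

Lemma mem_word t : we t \in W.
Proof. by apply: group_prod => i _; apply: mem_simple. Qed.

Lemma simple_mulK i : s i * s i = 1.
Proof. by rewrite -(BN_invol BN i) expgS expg1. Qed.

Lemma simpleV i : (s i)^-1 = s i.
Proof. by apply/eqP; rewrite eq_sym eq_mulgV1 invgK simple_mulK. Qed.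

Lemma simpleK i w : s i * (s i * w) = w.
Proof. by rewrite mulgA simple_mulK mul1g. Qed.

Lemma word_elt_rev t : we (rev t) = (we t)^-1.
Proof.
elim: t => [|i t IH]; first by rewrite word_elt_nil invg1.
by rewrite rev_cons word_elt_rcons IH word_elt_cons invMg simpleV.
Qed.

Lemma gen_word (A : {pred 'I_r}) w :
  w \in <<[set s j | j in A]>> -> exists2 t, all (mem A) t & we t = w.
Proof.
case/gen_prodgP=> n [c cA ->]; elim: n c cA => [|n IH] c cA.
  by exists [::] => //; rewrite word_elt_nil big_ord0.
rewrite big_ord_recl; have /imsetP[j Aj ->] := cA ord0.
have [|t At Et] := IH (fun i => c (lift ord0 i)); first by move=> i; apply: cA.
by exists (j :: t); rewrite /= ?At ?andbT // word_elt_cons Et.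
Qed.

Lemma len_word t : (l (we t) <= size t)%N.
Proof.
rewrite /weyl_length; set p := (X in find X _).
have [tW|Wt] := ltnP (size t) #|W|; last first.
  by apply: leq_trans Wt; rewrite -[X in (_ <= X)%N](size_iota 0) find_size.
have pt : p (size t) by apply/existsP; exists (in_tuple t).
rewrite leqNgt; apply/negP=> /(before_find 0%N).
by rewrite nth_iota // add0n pt.
Qed.

(** The search in [weyl_length] stops at #|W|, so the point is that a shortest word has fewer than
    #|W| letters. *)
Lemma reduced_word w : w \in W -> exists2 t, we t = w & size t = l w.
Proof.
move=> Ww; pose q k := `[< exists2 t, we t = w & size t = k >].
have exq : exists k, q k.
  move: Ww; rewrite -(BN_weyl_gen BN) => /gen_word[t _ Et].
  by exists (size t); apply/asboolP; exists t.
case: (ex_minnP exq) => k /asboolP[t Et <-{k}] min_t.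
exists t => //; apply/eqP; rewrite eqn_leq -{2}Et len_word andbT.
have ltW : (size t < #|W|)%N.
  rewrite ltnNge; apply/negP=> leWt.
  (* Pigeonhole on the products of the prefixes: if two agree, the letters between them can be cut
     out. *)
  pose f (i : 'I_(size t).+1) := we (take i t).
  have : ~~ injectiveb f.
    apply/negP=> /injectiveP inj_f.
    have: (#|'I_(size t).+1| <= #|W|)%N.
      rewrite -(card_imset predT inj_f) subset_leq_card //.
      by apply/subsetP=> _ /imsetP[i _ ->]; apply: mem_word.
    by rewrite card_ord ltnNge leWt.
  case/injectivePn=> i1 [i2].
  wlog lt12 : i1 i2 / (i1 < i2)%N => [IH n12 E|_ E].
    by have := n12; rewrite neq_ltn => /orP[/IH|/IH]; apply; rewrite // eq_sym.
  have: q (size (take i1 t ++ drop i2 t)).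
    apply/asboolP; exists (take i1 t ++ drop i2 t) => //.
    by rewrite word_elt_cat [we (take i1 t)]E -word_elt_cat cat_take_drop.
  move/min_t; rewrite size_cat size_take size_drop.
  have := ltn_ord i2; rewrite ltnS => le2; rewrite (leq_trans lt12 le2).
  by rewrite -{1}(subnKC le2) leq_add2r leqNgt lt12.
rewrite /weyl_length; set p := (X in find X _).
have hasp : has p (iota 0 #|W|).
  apply/hasP; exists (size t); first by rewrite mem_iota.
  by apply/existsP; exists (in_tuple t); apply/eqP.
have := nth_find 0%N hasp; rewrite nth_iota ?add0n; last first.
  by rewrite -[X in (_ < X)%N](size_iota 0) -has_find.
case/existsP=> u /eqP Eu; apply: min_t; apply/asboolP; exists u => //.
exact: size_tuple.
Qed.

Lemma len1 : l 1 = 0%N.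
Proof. by apply/eqP; rewrite -leqn0 -word_elt_nil len_word. Qed.

Lemma len_eq0 w : w \in W -> (l w == 0%N) = (w == 1).
Proof.
move=> Ww; apply/eqP/eqP=> [l0|->]; last exact: len1.
have [t Et] := reduced_word Ww.
by rewrite l0 -Et => /size0nil->; apply: word_elt_nil.
Qed.

Lemma len_mul w w' : w \in W -> w' \in W -> (l (w * w') <= l w + l w')%N.
Proof.
move=> /reduced_word[t <- <-] /reduced_word[t' <- <-].
by rewrite -word_elt_cat -size_cat len_word.
Qed.

Lemma len_inv w : w \in W -> l w^-1 = l w.
Proof.
have le v : v \in W -> (l v^-1 <= l v)%N.
  by move=> /reduced_word[t <- <-]; rewrite -word_elt_rev -size_rev len_word.
by move=> Ww; apply/eqP; rewrite eqn_leq le // -{1}[w]invgK le ?groupV.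
Qed.

Lemma len_simple i : (l (s i) <= 1)%N.
Proof. by rewrite -word_elt1 len_word. Qed.

Lemma len_simplel i w : w \in W -> (l (s i * w) <= (l w).+1)%N.
Proof.
move=> Ww; apply: leq_trans (len_mul (mem_simple i) Ww) _.
by rewrite -[X in (_ <= X)%N]add1n leq_add2r len_simple.
Qed.

Lemma len_simplel_ge i w : w \in W -> (l w <= (l (s i * w)).+1)%N.
Proof.
by move=> Ww; rewrite -{1}(simpleK i w) len_simplel // groupM ?mem_simple.
Qed.

Lemma len_gt0 w : w \in W -> (0 < l w)%N ->
  exists i v, [/\ v \in W, w = s i * v & l w = (l v).+1].
Proof.
move=> Ww; have [[|i t] Et Dl] := reduced_word Ww; first by rewrite -Dl.
exists i, (we t); rewrite mem_word -word_elt_cons; split=> //.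
apply/eqP; rewrite eqn_leq -{2}Dl /= ltnS len_word andbT.
by rewrite -Et word_elt_cons len_simplel ?mem_word.
Qed.

(** Length is subadditive and bounded by word size, so equality for the whole word forces it for
    both factors. *)
Lemma word_eltI t1 t2 : l (we (t1 ++ t2)) = size (t1 ++ t2) ->
  l (we t1) = size t1 /\ l (we t2) = size t2.
Proof.
rewrite size_cat word_elt_cat => E.
have := len_mul (mem_word t1) (mem_word t2); rewrite E.
have := len_word t1; have := len_word t2.
move: (l _) (l _) => a b ha hb hab; split; apply/eqP; rewrite eqn_leq.
  by rewrite hb -(leq_add2r (size t2)) (leq_trans hab) // leq_add2l.
by rewrite ha -(leq_add2l (size t1)) (leq_trans hab) // leq_add2r.
Qed.

End WeylGroup.

(** * Bruhat cells and their disjointness *)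

Section BruhatCells.

Variables (gT : finGroupType) (G B N : {group gT}) (r : nat).
Variable s : 'I_r -> coset_of (B :&: N)%G.
Hypothesis BN : BN_pair G s.

Local Notation H := (B :&: N)%G.
Local Notation W := (N / H).
Local Notation l := (weyl_length s).
Local Notation sW := (mem_simple BN).

Lemma norm_weyl : N \subset 'N(H).
Proof. exact: normal_norm (BN_normal BN). Qed.

Lemma weyl_rep w : w \in W -> exists2 n, n \in N & coset H n = w.
Proof. by case/morphimP=> n _ Nn ->; exists n. Qed.

Lemma weyl_repr w : w \in W -> repr w \in N.
Proof.
case/weyl_rep=> n Nn <-; have nHn := subsetP norm_weyl _ Nn.
have: repr (coset H n) \in coset H n by apply: mem_repr_coset.
rewrite val_coset // => /rcosetP[h /setIP[_ Nh] ->].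
exact: groupM.
Qed.

Lemma coset_weylM x y : x \in N -> y \in N ->
  coset H (x * y) = coset H x * coset H y.
Proof. by move=> Nx Ny; rewrite morphM ?(subsetP norm_weyl). Qed.

Lemma coset_weylV x : x \in N -> coset H x^-1 = (coset H x)^-1.
Proof. by move=> Nx; rewrite morphV ?(subsetP norm_weyl). Qed.

Lemma mem_coset_weyl x : x \in N -> coset H x \in W.
Proof. by move=> Nx; rewrite mem_quotient. Qed.

Lemma coset_weyl_eq x y : x \in N -> y \in N -> coset H x = coset H y ->
  exists2 h, h \in H & x = h * y.
Proof.
move=> Nx Ny E; have := subsetP norm_weyl _ Nx; have := subsetP norm_weyl _ Ny.
move=> nHy nHx; apply/rcosetP; rewrite -val_coset // -E val_coset //.
exact: rcoset_refl.
Qed.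

Definition bruhat_cell (w : coset_of H) : {set gT} := B :* repr w * B.

Lemma bruhat_cellP n g : n \in N ->
  g \in bruhat_cell (coset H n) <->
  exists b b', [/\ b \in B, b' \in B & g = b * n * b'].
Proof.
move=> Nn; have Nr := weyl_repr (mem_coset_weyl Nn).
have [h /setIP[Bh _] Eh] : exists2 h, h \in H & repr (coset H n) = h * n.
  by apply: coset_weyl_eq; rewrite // coset_reprK.
rewrite /bruhat_cell Eh; split=> [/mulsgP[_ b' /rcosetP[b Bb ->] Bb' ->]|].
  by exists (b * h), b'; rewrite groupM // !mulgA.
case=> b [b' [Bb Bb' ->]]; apply/mulsgP; exists (b * n) b' => //.
by apply/rcosetP; exists (b * h^-1); rewrite ?groupM ?groupV // mulgA mulgKV.
Qed.

Lemma bruhat_cell_rep n : n \in N -> n \in bruhat_cell (coset H n).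
Proof. by move=> Nn; apply/bruhat_cellP => //; exists 1, 1; rewrite mul1g mulg1. Qed.

Lemma bruhat_cellMl w b g : b \in B ->
  (b * g \in bruhat_cell w) = (g \in bruhat_cell w).
Proof.
move=> Bb; have st x a : a \in B -> x \in bruhat_cell w -> a * x \in bruhat_cell w.
  move=> Ba /mulsgP[_ b' /rcosetP[c Bc ->] Bb' ->]; rewrite !mulgA.
  by rewrite mem_mulg // mem_rcoset mulgK groupM.
by apply/idP/idP=> [/(st _ b^-1)|]; [rewrite groupV mulKg; apply | apply: st].
Qed.

Lemma bruhat_cellMr w b g : b \in B ->
  (g * b \in bruhat_cell w) = (g \in bruhat_cell w).
Proof.
move=> Bb; have st x a : a \in B -> x \in bruhat_cell w -> x * a \in bruhat_cell w.
  move=> Ba /mulsgP[y b' Hy Bb' ->]; rewrite -!mulgA.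
  by rewrite mem_mulg // groupM.
by apply/idP/idP=> [/(st _ b^-1)|]; [rewrite groupV mulgK; apply | apply: st].
Qed.

Lemma bruhat_cell1 g : (g \in bruhat_cell 1) = (g \in B).
Proof.
have /= <- := morph1 (coset_morphism H).
apply/idP/idP=> [/bruhat_cellP[] // b [b' [Bb Bb' ->]]|Bg].
  by rewrite mulg1 groupM.
by apply/bruhat_cellP => //; exists g, 1; rewrite !mulg1.
Qed.

Lemma bruhat_cell_ex w : w \in W -> exists g, g \in bruhat_cell w.
Proof. by case/weyl_rep=> n Nn <-; exists n; apply: bruhat_cell_rep. Qed.

Lemma bruhat_cellV w g : w \in W ->
  g \in bruhat_cell w -> g^-1 \in bruhat_cell w^-1.
Proof.
case/weyl_rep=> n Nn <-; case/bruhat_cellP=> // b [b' [Bb Bb' ->]].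
rewrite -coset_weylV //; apply/bruhat_cellP; rewrite ?groupV //.
by exists b'^-1, b^-1; rewrite !groupV !invMg mulgA.
Qed.

Lemma bruhat_cell_split w1 w2 g : w1 \in W -> w2 \in W ->
    g \in bruhat_cell (w1 * w2) ->
  exists g1 g2, [/\ g1 \in bruhat_cell w1, g2 \in bruhat_cell w2 & g = g1 * g2].
Proof.
case/weyl_rep=> n Nn <- /weyl_rep[n' Nn' <-]; rewrite -coset_weylM //.
case/bruhat_cellP=> [|b [b' [Bb Bb' ->]]]; first exact: groupM.
exists (b * n), (n' * b').
by rewrite bruhat_cellMl ?bruhat_cellMr ?bruhat_cell_rep // !mulgA.
Qed.

Lemma bruhat_cellM i w g g' : w \in W ->
    g \in bruhat_cell (s i) -> g' \in bruhat_cell w ->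
  (g * g' \in bruhat_cell (s i * w)) || (g * g' \in bruhat_cell w).
Proof.
move=> /weyl_rep[n' Nn' <-]; have [n Nn Dn] := weyl_rep (sW i); rewrite -Dn.
case/bruhat_cellP=> // b [b' [Bb Bb' ->]] /bruhat_cellP[] // a [a' [Ba Ba' ->]].
have -> : b * n * b' * (a * n' * a') = b * (n * (b' * a) * n' * a').
  by rewrite !mulgA.
rewrite -coset_weylM // !(bruhat_cellMl _ _ Bb) !(bruhat_cellMr _ _ Ba').
have nBn' : n * (b' * a) * n' \in [set n] * B * [set n'].
  by apply: mem_mulg; rewrite ?set11 //; apply: mem_mulg; rewrite ?set11 ?groupM.
have := subsetP (BN_mul BN Nn Dn Nn') _ nBn'.
case/setUP=> /mulsgP[_ c' /rcosetP[c Bc ->] Bc' ->];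
rewrite !(bruhat_cellMr _ _ Bc') !(bruhat_cellMl _ _ Bc) bruhat_cell_rep ?groupM //.
by rewrite orbT.
Qed.

Lemma bruhat_cellM_r i w g g' : w \in W ->
    g \in bruhat_cell w -> g' \in bruhat_cell (s i) ->
  (g * g' \in bruhat_cell (w * s i)) || (g * g' \in bruhat_cell w).
Proof.
move=> Ww /(bruhat_cellV Ww) Dg /(bruhat_cellV (sW i)) Dg'.
rewrite (simpleV BN) in Dg'.
have Wv : w^-1 \in W by rewrite groupV.
have := bruhat_cellM Wv Dg' Dg.
have Wsv : s i * w^-1 \in W by rewrite groupM ?sW.
case/orP => [/(bruhat_cellV Wsv)|/(bruhat_cellV Wv)];
by rewrite !invMg !invgK ?(simpleV BN) => ->; rewrite ?orbT.
Qed.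

Lemma bruhat_cell_inj w w' g : w \in W -> w' \in W ->
  g \in bruhat_cell w -> g \in bruhat_cell w' -> w = w'.
Proof.
move: {2}(l w) (leqnn (l w)) => k.
wlog lww' : w w' / (l w <= l w')%N => [IH lwk Ww Ww' gw gw'|].
  have [le|lt] := leqP (l w) (l w'); first exact: IH.
  by apply/esym/(IH w' w) => //; apply: ltnW => //; apply: leq_trans lt lwk.
elim: k => [|k IH] in w w' g lww' * => lwk Ww Ww' gw gw'.
  move: lwk; rewrite leqn0 (len_eq0 BN) // => /eqP Dw; rewrite Dw in gw *.
  rewrite bruhat_cell1 in gw; have [n' Nn' Dn'] := weyl_rep Ww'.
  move: gw'; rewrite -Dn' => /bruhat_cellP[] // b [b' [Bb Bb' Eg]].
  rewrite coset_id // inE Nn' andbT.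
  by have := gw; rewrite Eg groupMr // groupMl.
have [l0|l_gt0] := posnP (l w); first by apply: (IH w w' g); rewrite ?l0.
have [i [v [Wv Dw Dl]]] := len_gt0 BN Ww l_gt0.
rewrite Dw in gw; have [x [y [Dx Dy Eg]]] := bruhat_cell_split (sW i) Wv gw.
have: y = x^-1 * g by rewrite Eg mulKg.
have Dx' : x^-1 \in bruhat_cell (s i) by rewrite -(simpleV BN) bruhat_cellV ?sW.
have lvk : (l v <= k)%N by rewrite -ltnS -Dl.
have lvw' : (l v < l w')%N by rewrite -Dl.
(* Now y lies in the cell of v and in that of [s i * w'] or of w'. The latter would give v = w' by
   induction, against l v < l w'. *)
have := bruhat_cellM Ww' Dx' gw' => /orP[] Dy' Ey; rewrite -Ey in Dy'.
  have Wsw' : s i * w' \in W by rewrite groupM ?sW.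
  have lvsw' : (l v <= l (s i * w'))%N.
    by have := leq_trans lvw' (len_simplel_ge BN i Ww').
  by rewrite Dw (IH v _ y lvsw' lvk Wv Wsw' Dy Dy') (simpleK BN).
have Ev := IH v w' y (ltnW lvw') lvk Wv Ww' Dy Dy'.
by rewrite Ev ltnn in lvw'.
Qed.

End BruhatCells.

(** * Products of cells, lengths and the exchange condition *)

Section Exchange.

Variables (gT : finGroupType) (G B N : {group gT}) (r : nat).
Variable s : 'I_r -> coset_of (B :&: N)%G.
Hypothesis BN : BN_pair G s.

Local Notation H := (B :&: N)%G.
Local Notation W := (N / H).
Local Notation l := (weyl_length s).
Local Notation we := (word_elt s).
Local Notation sW := (mem_simple BN).
Local Notation cell := bruhat_cell.

Lemma simple_neq1 i : s i != 1.
Proof.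
apply/eqP=> s1; have [n Nn Dn] := weyl_rep (sW i).
have /negP[] := BN_neq BN (group1 N) (etrans (morph1 (coset_morphism H)) (esym s1)).
by rewrite conjsg1.
Qed.

Lemma simple_mul_neq i w : s i * w != w.
Proof. by rewrite -{2}(mul1g w) (inj_eq (mulIg w)) simple_neq1. Qed.

(** The inequality between lengths is not strict, so that [len_simplel_neq] can use this lemma to
    refute equality. *)
Lemma bruhat_cellM_up i w g g' : w \in W -> (l w <= l (s i * w))%N ->
  g \in cell (s i) -> g' \in cell w -> g * g' \in cell (s i * w).
Proof.
move: {2}(l w) (leqnn (l w)) => k.
elim: k => [|k IH] in w g g' * => lwk Ww up Dg Dg'.
  move: lwk; rewrite leqn0 (len_eq0 BN) // => /eqP Dw.
  by move: Dg'; rewrite Dw (bruhat_cell1 BN) mulg1 => Bg'; rewrite bruhat_cellMr.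
have [l0|l_gt0] := posnP (l w); first by apply: IH; rewrite ?l0.
have Wv : w^-1 \in W by rewrite groupV.
have lv_gt0 : (0 < l w^-1)%N by rewrite (len_inv BN).
have [j [v [Wv' Dv Dl]]] := len_gt0 BN Wv lv_gt0.
have Dw : w = v^-1 * s j by rewrite -(simpleV BN) -invMg -Dv invgK.
have Wu : v^-1 \in W by rewrite groupV.
have Dlu : l w = (l v^-1).+1 by rewrite -(len_inv BN Ww) Dl (len_inv BN).
move: (v^-1) Wu Dw Dlu => u Wu Dw Dlu {v Wv' Dv Dl lv_gt0 Wv}.
have Wsu : s i * u \in W by rewrite groupM ?sW.
have Wsw : s i * w \in W by rewrite groupM ?sW.
have le_sw : (l (s i * w) <= (l (s i * u)).+1)%N.
  rewrite Dw mulgA; apply: leq_trans (len_mul BN Wsu (sW j)) _.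
  by rewrite -[X in (_ <= X)%N]addn1 leq_add2l (len_simple s).
have up_u : (l u <= l (s i * u))%N.
  by rewrite -ltnS -Dlu; apply: leq_trans up le_sw.
(* Bad case: [g * g'] is in the cell of w = u s_j. Then g x is in the cell of s_i u by induction,
   and in that of u or w after removal of y. The first gives s_i u = u, the second s_i w = u, which
   is shorter than w. *)
have /orP[//|Dgg'] := bruhat_cellM BN Ww Dg Dg'.
rewrite Dw in Dg'; have [x [y [Dx Dy Eg']]] := bruhat_cell_split BN Wu (sW j) Dg'.
have luk : (l u <= k)%N by rewrite -ltnS -Dlu.
have Dgx := IH u g x luk Wu up_u Dg Dx.
have Dy' : y^-1 \in cell (s j) by rewrite -(simpleV BN) (bruhat_cellV BN) ?sW.
have Egx : g * x = g * g' * y^-1 by rewrite Eg' mulgA mulgK.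
have := bruhat_cellM_r BN Ww Dgg' Dy'; rewrite -Egx => /orP[] Dgx'.
  have Eu : s i * u = u.
    rewrite (bruhat_cell_inj BN Wsu _ Dgx Dgx') ?groupM ?sW //.
    by rewrite Dw -mulgA (simple_mulK BN) mulg1.
  by case/eqP: (simple_mul_neq i u).
have Eu := bruhat_cell_inj BN Wsu Ww Dgx Dgx'.
by move: up; rewrite -{2}Eu (simpleK BN) Dlu ltnn.
Qed.

(** As B is not normalised by s_i, the product of the cell of s_i with itself is more than B. These
    x and y drive [len_simplel_neq] and [folding]. *)
Lemma bruhat_cell_simple i : exists x y,
  [/\ x \in cell (s i), y \in cell (s i) & x * y \in cell (s i)].
Proof.
have [n Nn Dn] := weyl_rep (sW i).
have /subsetPn[_ /imsetP[b Bb ->] nBb] : ~~ (B :^ n \subset B).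
  by apply: contra (BN_neq BN Nn Dn) => sBB; rewrite eqEcard cardJg leqnn sBB.
have Dnn : n \in cell (s i) by rewrite -Dn (bruhat_cell_rep BN).
have Dx : n^-1 * b \in cell (s i).
  by rewrite bruhat_cellMr // -(simpleV BN) (bruhat_cellV BN) ?sW.
exists (n^-1 * b), n; split=> //.
have := bruhat_cellM BN (sW i) Dx Dnn.
by rewrite (simple_mulK BN) (bruhat_cell1 BN) -mulgA -conjgE (negPf nBb).
Qed.

Lemma len_simplel_neq i w : w \in W -> l (s i * w) != l w.
Proof.
move=> Ww; apply/eqP=> E; have [x [y [Dx Dy Dxy]]] := bruhat_cell_simple i.
have [z Dz] := bruhat_cell_ex BN Ww.
have Wsw : s i * w \in W by rewrite groupM ?sW.
(* With equal lengths, x y z lies in two cells: as (x y) z in that of s_i w, as x (y z) in that of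
   w. *)
have Dyz : y * z \in cell (s i * w) by apply: bruhat_cellM_up; rewrite // E.
have Dxyz : x * y * z \in cell (s i * w) by apply: bruhat_cellM_up; rewrite // E.
have : x * (y * z) \in cell (s i * (s i * w)).
  by apply: bruhat_cellM_up; rewrite ?(simpleK BN) ?E.
rewrite (simpleK BN) mulgA => /(bruhat_cell_inj BN Wsw Ww Dxyz) /eqP.
by rewrite (negPf (simple_mul_neq i w)).
Qed.

Lemma len_simplel_up i w : w \in W -> (l w < l (s i * w))%N ->
  l (s i * w) = (l w).+1.
Proof. by move=> Ww up; apply/eqP; rewrite eqn_leq up (len_simplel BN). Qed.

Lemma len_simplel_down i w : w \in W -> (l (s i * w) < l w)%N ->
  l w = (l (s i * w)).+1.
Proof. by move=> Ww up; apply/eqP; rewrite eqn_leq up (len_simplel_ge BN). Qed.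

Lemma len_simplelP i w : w \in W ->
  (l (s i * w) < l w)%N = ~~ (l w < l (s i * w))%N.
Proof. by move=> Ww; rewrite -leqNgt ltn_neqAle len_simplel_neq. Qed.

(* Condition (C) of Bourbaki, Groupes et algebres de Lie, IV.1.7. *)
Lemma folding i j w : w \in W -> (l w < l (s i * w))%N ->
  (l (s i * (w * s j)) < l (w * s j))%N -> s i * w = w * s j.
Proof.
move=> Ww up down; have [x [y [Dx Dy Dxy]]] := bruhat_cell_simple i.
have Wwj : w * s j \in W by rewrite groupM ?sW.
have Wv : s i * (w * s j) \in W by rewrite groupM ?sW.
have Wsw : s i * w \in W by rewrite groupM ?sW.
have [z Dz] := bruhat_cell_ex BN Wv.
have up_v : (l (s i * (w * s j)) <= l (s i * (s i * (w * s j))))%N.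
  by rewrite (simpleK BN) ltnW.
have Dyz : y * z \in cell (w * s j).
  by rewrite -(simpleK BN i (w * s j)); apply: bruhat_cellM_up.
have Dxyz : x * (y * z) \in cell (w * s j).
  by rewrite mulgA -(simpleK BN i (w * s j)); apply: bruhat_cellM_up.
have [a [b [Da Db Eyz]]] := bruhat_cell_split BN Ww (sW j) Dyz.
have Dxa : x * a \in cell (s i * w) by apply: bruhat_cellM_up => //; apply: ltnW.
have Db' : b^-1 \in cell (s j) by rewrite -(simpleV BN) (bruhat_cellV BN) ?sW.
(* The element x a is in the cell of s_i w and, by removal of b from x y z, in that of w or of w
   s_j. *)
have Exa : x * a = x * (y * z) * b^-1 by rewrite Eyz !mulgA mulgK.
have := bruhat_cellM_r BN Wwj Dxyz Db'; rewrite -Exa => /orP[] Dxa'.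
  rewrite -mulgA (simple_mulK BN) mulg1 in Dxa'.
  by case/eqP: (simple_mul_neq i w); apply: (bruhat_cell_inj BN Wsw Ww Dxa Dxa').
exact: (bruhat_cell_inj BN Wsw Wwj Dxa Dxa').
Qed.

(** Along the prefixes of t, [s i] lengthens at first and shortens in the end; [folding] applies at
    the letter where this changes. *)
Lemma exchange i t : (l (s i * we t) < l (we t))%N ->
  exists t1 j t2, t = t1 ++ j :: t2 /\ s i * we t1 = we t1 * s j.
Proof.
move=> down; suff: forall a b, t = a ++ b ->
      (l (we a) < l (s i * we a))%N ->
    exists t1 j t2, t = t1 ++ j :: t2 /\ s i * we t1 = we t1 * s j.
  apply; first exact: (erefl ([::] ++ t)).
  rewrite word_elt_nil mulg1 len1 lt0n (len_eq0 BN) ?sW //.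
  exact: simple_neq1.
move=> a b; elim: b => [|j b IH] in a *.
  by rewrite cats0 => <- /(ltn_trans down); rewrite ltnn.
move=> Dt up; have [up2|] := boolP (l (we (rcons a j)) < l (s i * we (rcons a j)))%N.
  by apply: IH up2; rewrite cat_rcons.
rewrite -(len_simplelP i (mem_word BN _)) word_elt_rcons => down2.
by exists a, j, b; split=> //; apply: folding up down2; apply: mem_word BN _.
Qed.

Lemma exchange_word i t : (l (s i * we t) < l (we t))%N ->
  exists t1 j t2, t = t1 ++ j :: t2 /\ s i * we t = we (t1 ++ t2).
Proof.
case/exchange=> t1 [j [t2 [-> E]]]; exists t1, j, t2; split=> //.
by rewrite !word_elt_cat word_elt_cons mulgA E -mulgA (simpleK BN).
Qed.

Lemma len_simpler i w : w \in W -> l (w * s i) = l (s i * w^-1).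
Proof. by move=> Ww; rewrite -(len_inv BN) ?groupM ?sW // invMg (simpleV BN). Qed.

Lemma len_simplerP i w : w \in W ->
  (l (w * s i) < l w)%N = ~~ (l w < l (w * s i))%N.
Proof.
move=> Ww; rewrite len_simpler // -(len_inv BN Ww) len_simplelP //.
by rewrite groupV.
Qed.

Lemma len_simpler_up i w : w \in W -> (l w < l (w * s i))%N ->
  l (w * s i) = (l w).+1.
Proof.
move=> Ww; rewrite len_simpler // -(len_inv BN Ww) => up.
by rewrite len_simplel_up ?groupV.
Qed.

Lemma len_simpler_down i w : w \in W -> (l (w * s i) < l w)%N ->
  l w = (l (w * s i)).+1.
Proof.
move=> Ww; rewrite len_simpler // -(len_inv BN Ww) => down.
by rewrite -len_simplel_down ?groupV.
Qed.

Lemma exchange_rcons i t : (l (we t * s i) < l (we t))%N ->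
  exists t1 j t2, t = t1 ++ j :: t2 /\ we t * s i = we (t1 ++ t2).
Proof.
rewrite len_simpler ?(mem_word BN) // -(len_inv BN (mem_word BN t)).
rewrite -(word_elt_rev BN) => /exchange_word[t1 [j [t2 [Dt E]]]].
exists (rev t2), j, (rev t1); split.
  by rewrite -(revK t) Dt rev_cat rev_cons cat_rcons.
by rewrite -rev_cat !(word_elt_rev BN) -E (word_elt_rev BN) invMg invgK (simpleV BN).
Qed.

End Exchange.

(** * Root subgroups *)

Section LongestElement.

Variables (gT : finGroupType) (G B N : {group gT}) (r : nat).
Variable s : 'I_r -> coset_of (B :&: N)%G.
Hypothesis BN : BN_pair G s.

Local Notation H := (B :&: N)%G.
Local Notation W := (N / H).
Local Notation l := (weyl_length s).
Local Notation we := (word_elt s).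
Local Notation w0 := (longest_elt s).

Lemma longest_mem : w0 \in W.
Proof. by rewrite /longest_elt; case: arg_maxnP; rewrite ?group1. Qed.

Lemma longest_max w : w \in W -> (l w <= l w0)%N.
Proof.
rewrite /longest_elt; case: arg_maxnP => [|v _ maxv]; first exact: group1.
exact: maxv.
Qed.

(** Induction on t from the right: [s i] shortens z ++ t, so exchange deletes a letter. As
    [rcons t i] is reduced, this letter is in z, and dropping it makes room for i. *)
Lemma longest_word t : l (we t) = size t ->
  exists2 z, we (z ++ t) = w0 & size (z ++ t) = l w0.
Proof.
elim/last_ind: t => [|t i IH] Dl.
  by have [z Ez Dz] := reduced_word BN longest_mem; exists z; rewrite cats0.
have [Dt _] : l (we t) = size t /\ l (we [:: i]) = size [:: i].
  by apply: (word_eltI BN); rewrite cats1.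
have [z Ez Dz] := IH Dt; have W0 := longest_mem.
have down : (l (w0 * s i) < l w0)%N.
  rewrite (len_simplerP BN) // -leqNgt longest_max //.
  by rewrite groupM ?(mem_simple BN).
rewrite -Ez in down.
have [t1 [j [t2 [E Ew]]]] := exchange_rcons BN down.
have Et1 : t1 = take (size t1) (z ++ t) by rewrite E take_size_cat.
have Et2 : j :: t2 = drop (size t1) (z ++ t) by rewrite E drop_size_cat.
move: Et1 Et2; rewrite take_cat drop_cat; case: ltnP => lt1 Et1 Et2.
  case Ed: (drop (size t1) z) Et2 => [|j' z2] /=.
    have := size_drop (size t1) z.
    by rewrite Ed => /esym/eqP; rewrite subn_eq0 leqNgt lt1.
  case=> _ Et2; exists (t1 ++ z2).
    rewrite -cats1 !catA word_elt_cat word_elt1 -(catA t1) -Et2 -Ew.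
    by rewrite Ez -mulgA (simple_mulK BN) mulg1.
  by rewrite -Dz E Et2 -rcons_cat size_rcons !size_cat /= !size_cat !addnS addnA.
have Ewt : we t * s i = we (take (size t1 - size z) t ++ t2).
  by apply: (mulgI (we z)); rewrite mulgA -!word_elt_cat Ew catA -Et1.
have : (l (we (rcons t i)) <= size t)%N.
  rewrite word_elt_rcons Ewt; apply: leq_trans (len_word _ _) _.
  rewrite -[in X in (_ <= X)%N](cat_take_drop (size t1 - size z) t) -Et2.
  by rewrite !size_cat leq_add2l /=.
by rewrite Dl size_rcons ltnn.
Qed.

Lemma longest_additive w : w \in W -> (l (w0 * w^-1) + l w = l w0)%N.
Proof.
move=> Ww; have [t Et Dt] := reduced_word BN Ww.
have [|z Ez Dz] := @longest_word t; first by rewrite Et Dt.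
have [Dlz _] : l (we z) = size z /\ l (we t) = size t.
  by apply: (word_eltI BN); rewrite Ez.
have -> : w0 * w^-1 = we z by rewrite -Ez word_elt_cat Et mulgK.
by rewrite Dlz -Dt -size_cat.
Qed.

Lemma len_longestl w : w \in W -> l (w0 * w) = (l w0 - l w)%N.
Proof.
move=> Ww; have Wv : w^-1 \in W by rewrite groupV.
by rewrite -(longest_additive Wv) invgK (len_inv BN) // addnK.
Qed.

Lemma len_longestr w : w \in W -> l (w * w0^-1) = (l w0 - l w)%N.
Proof.
move=> Ww; have Wv : w^-1 \in W by rewrite groupV.
rewrite -(len_inv BN) ?groupM ?groupV ?longest_mem // invMg invgK.
by rewrite len_longestl // (len_inv BN).
Qed.

End LongestElement.

(** * Intersections of conjugates of B *)

Section SplitBNPair.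

Variables (gT : finGroupType) (G B N U : {group gT}) (p r : nat).
Variable s : 'I_r -> coset_of (B :&: N)%G.
Hypothesis sBN : split_BN_pair G s p U.

Local Notation H := (B :&: N)%G.
Local Notation W := (N / H).
Local Notation l := (weyl_length s).
Local Notation cell := bruhat_cell.
Local Notation BN := (split_BN sBN).
Local Notation sW := (mem_simple BN).

Lemma split_U_normal : U <| B.
Proof. by have [] := sdprod_context (split_B sBN). Qed.

Lemma split_U_Hall : p.-Hall(B) U.
Proof.
rewrite /pHall (normal_sub split_U_normal) (split_U sBN) /=.
have := sdprod_card (split_B sBN); rewrite -(Lagrange (normal_sub split_U_normal)).
move/eqP; rewrite eqn_pmul2l ?cardG_gt0 // => /eqP <-.
exact: split_H sBN.
Qed.

Lemma mem_split_U x : x \in B -> p.-elt x -> x \in U.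
Proof.
by move=> Bx; rewrite (mem_normal_Hall split_U_Hall split_U_normal Bx).
Qed.

Lemma split_U_conj_p g x : x \in U :^ g -> p.-elt x.
Proof. by apply: mem_p_elt; rewrite pgroupJ (split_U sBN). Qed.

Lemma split_H_norm : H \subset 'N(U).
Proof. by have [_ _ _ ->] := sdprod_context (split_B sBN). Qed.

Lemma split_H_normB : H \subset 'N(B).
Proof. exact: subset_trans (subsetIl _ _) (normG B). Qed.

Lemma conj_weyl (A : {set gT}) n : H \subset 'N(A) -> n \in N ->
  A :^ repr (coset H n) = A :^ n.
Proof.
move=> nAH Nn; have Nr : repr (coset H n) \in N by rewrite (weyl_repr BN) ?mem_coset_weyl.
have [h Hh ->] := coset_weyl_eq BN Nr Nn (coset_reprK _).
by rewrite conjsgM (normP (subsetP nAH _ Hh)).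
Qed.

Lemma conj_weylM (A : {set gT}) w w' : H \subset 'N(A) -> w \in W -> w' \in W ->
  A :^ repr (w * w') = (A :^ repr w) :^ repr w'.
Proof.
move=> nAH Ww Ww'; have [Nw Nw'] := (weyl_repr BN Ww, weyl_repr BN Ww').
rewrite -conjsgM -(conj_weyl nAH (groupM Nw Nw')) (coset_weylM BN) //.
by rewrite !coset_reprK.
Qed.

Lemma conj_weyl1 (A : {set gT}) : H \subset 'N(A) -> A :^ repr (1 : coset_of H) = A.
Proof.
move=> nAH; have E : coset H 1 = (1 : coset_of H) by apply: coset_id.
by rewrite -E conj_weyl ?conjsg1.
Qed.

Lemma conj_weylV (A : {set gT}) w : H \subset 'N(A) -> w \in W ->
  A :^ repr w^-1 = A :^ (repr w)^-1.
Proof.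
move=> nAH Ww; have Nw := weyl_repr BN Ww.
by rewrite -(conj_weyl nAH (groupVr Nw)) (coset_weylV BN) // coset_reprK.
Qed.

Lemma norm_conj_weyl (A : {set gT}) n : H \subset 'N(A) -> n \in N ->
  H \subset 'N(A :^ n).
Proof.
move=> nAH Nn; rewrite normJ -(normP (subsetP (norm_weyl BN) _ Nn)) conjSg.
exact: nAH.
Qed.

Lemma conj_simple_cell i x : x \in B :^ repr (s i) ->
  (x \in B) || (x \in cell (s i)).
Proof.
have Ns := weyl_repr BN (sW i); case/imsetP=> b Bb ->.
have Dn : repr (s i) \in cell (s i).
  by rewrite -{2}[s i]coset_reprK (bruhat_cell_rep BN).
have Dm : (repr (s i))^-1 * b \in cell (s i).
  by rewrite bruhat_cellMr // -{2}(simpleV BN) (bruhat_cellV BN) ?sW.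
have := bruhat_cellM BN (sW i) Dm Dn.
by rewrite (simple_mulK BN) (bruhat_cell1 BN) -mulgA -conjgE.
Qed.

(** An x in the cell of s_i would have x w in the cell of s_i w, whereas x in w B w^-1 puts x w in
    the cell of w. *)
Lemma conj_B_simple i w x : w \in W -> (l w < l (s i * w))%N ->
  x \in B :^ repr (s i) -> x \in B :^ repr w^-1 -> x \in B.
Proof.
move=> Ww up /conj_simple_cell/orP[//|Dx].
have Nw := weyl_repr BN Ww.
rewrite (conj_weylV split_H_normB Ww) mem_conjgV => Bx.
have Dw : repr w \in cell w by rewrite -{2}[w]coset_reprK (bruhat_cell_rep BN).
have Dxw : x * repr w \in cell (s i * w).
  by apply: (bruhat_cellM_up BN); rewrite // ltnW.
have Dxw' : x * repr w \in cell w by rewrite conjgC bruhat_cellMr.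
have Wsw : s i * w \in W by rewrite groupM ?sW.
by case/eqP: (simple_mul_neq BN i w); apply: (bruhat_cell_inj BN Wsw Ww Dxw Dxw').
Qed.

(** Conjugation by the last letter of a reduced word of w' moves that letter over to w;
    [conj_B_simple] then undoes the conjugation. *)
Lemma conj_B_additive w' w x : w' \in W -> w \in W ->
    l (w' * w) = (l w' + l w)%N ->
  x \in B :^ repr w' -> x \in B :^ repr w^-1 -> x \in B.
Proof.
move=> Ww'; have [t <- <-] := reduced_word BN Ww' => {w' Ww'}.
elim/last_ind: t => [|t i IH] in w x * => Ww.
  by move=> _; rewrite word_elt_nil (conj_weyl1 split_H_normB).
rewrite word_elt_rcons size_rcons -mulgA => Dl.
have Wsw : s i * w \in W by rewrite groupM ?sW.
have := len_mul BN (mem_word BN t) Wsw; rewrite Dl => le1.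
have up : (l w < l (s i * w))%N.
  rewrite -(ltn_add2l (size t)) -addSn.
  by apply: leq_trans le1 _; rewrite leq_add2r len_word.
have Dsw := len_simplel_up BN Ww up.
have nB := split_H_normB; have Nn := weyl_repr BN (sW i).
rewrite (conj_weylM nB (mem_word BN t) (sW i)) => Bx Bxw.
apply: (conj_B_simple Ww up _ Bxw).
move: Bx; rewrite !mem_conjg => Bx; apply: (IH (s i * w)) => //.
- by rewrite Dl Dsw addSnnS.
- by rewrite mem_conjg.
have nBw : H \subset 'N(B :^ repr w^-1).
  by rewrite norm_conj_weyl ?(weyl_repr BN) ?groupV.
rewrite invMg conj_weylM ?groupV ?sW // (conj_weylV nBw (sW i)).
by rewrite memJ_conjg.
Qed.

End SplitBNPair.

(** * Factorisations of U by root subgroups *)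

Section RootSubgroups.

Variables (gT : finGroupType) (G B N U : {group gT}) (p r : nat).
Variable s : 'I_r -> coset_of (B :&: N)%G.
Hypothesis sBN : split_BN_pair G s p U.

Local Notation H := (B :&: N)%G.
Local Notation W := (N / H).
Local Notation l := (weyl_length s).
Local Notation w0 := (longest_elt s).
Local Notation cell := bruhat_cell.
Local Notation BN := (split_BN sBN).
Local Notation sW := (mem_simple BN).
Local Notation W0 := (longest_mem s).
Local Notation X := (simple_root_subgroup s U).
Local Notation nUH := (split_H_norm sBN).
Local Notation nBH := (split_H_normB B N).
Local Notation sUB := (normal_sub (split_U_normal sBN)).

Lemma mem_U_conj g x : x \in B -> x \in U :^ g -> x \in U.
Proof. by move=> Bx /(split_U_conj_p sBN); apply: (mem_split_U sBN). Qed.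

(** For every w, lengths add in w0 = (w0 w^-1) w, so [conj_B_additive] puts the intersection inside
    B^w. Saturation leaves H, whose order is prime to that of U. *)
Lemma tiU_longest : U :&: U :^ repr w0 = 1.
Proof.
apply/trivgP; rewrite -(coprime_TIg (pnat_coprime (split_U sBN) (split_H sBN))).
apply/subsetP=> x /setIP[Ux Uwx]; rewrite inE Ux /=.
rewrite -[gval H]/(B :&: N) -(split_saturated sBN); apply/bigcapP=> n Nn.
set w := coset H n; have Ww : w \in W by apply: mem_coset_weyl.
have Wv : w0 * w^-1 \in W by rewrite groupM ?groupV ?W0.
rewrite -(conj_weyl sBN nBH Nn) -/w mem_conjg.
apply: (conj_B_additive sBN Wv Ww).
- by have E := longest_additive BN Ww; rewrite mulgKV E.
- rewrite -mem_conjg -(conj_weylM sBN nBH) // mulgKV.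
  by apply: subsetP Uwx; rewrite conjSg sUB.
by rewrite (conj_weylV sBN nBH Ww) memJ_conjg (subsetP sUB).
Qed.

(** The element n u m is in the cell of w s_i; from n u m = v h n m b' one reads off x = v^n and y =
    (h^(n m) b')^(m^-1). *)
Lemma U_factor w i u : w \in W -> (l w < l (w * s i))%N -> u \in U ->
  exists x y, [/\ x \in U :&: U :^ repr w, y \in U :&: U :^ repr (s i)
                & u = x * y].
Proof.
move=> Ww up Uu; set n := repr w; set m := repr (s i).
have [Nn Nm] : n \in N /\ m \in N by rewrite !(weyl_repr BN) ?sW.
have Dn : n \in cell w by rewrite -[w]coset_reprK (bruhat_cell_rep BN).
have Dm : m \in cell (s i) by rewrite -[s i]coset_reprK (bruhat_cell_rep BN).
have Wws : w * s i \in W by rewrite groupM ?sW.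
have cell_up x y : x \in cell w -> y \in cell (s i) -> x * y \in cell (w * s i).
  move=> Dx Dy; rewrite -[x * y]invgK -[w * s i]invgK.
  apply: (bruhat_cellV BN); first by rewrite groupV.
  rewrite !invMg (simpleV BN); apply: (bruhat_cellM_up BN).
  - by rewrite groupV.
  - rewrite -(simpleV BN i) -invMg !(len_inv BN) //; exact: ltnW.
  - by rewrite -(simpleV BN) (bruhat_cellV BN) ?sW.
  exact: (bruhat_cellV BN).
have Bu := subsetP sUB _ Uu.
have Dnu : n * u \in cell w by rewrite bruhat_cellMr.
have := cell_up _ _ Dnu Dm.
have Dnm : coset H (n * m) = w * s i by rewrite (coset_weylM BN) ?coset_reprK.
rewrite -Dnm => /(bruhat_cellP BN)[]; first exact: groupM.
move=> b [b' [Bb Bb' E]].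
have [_ defUH _ _] := sdprodP (split_B sBN).
have /mulsgP[v h Uv Hh Db] : b \in U * H by rewrite defUH.
have Nnm := groupM Nn Nm.
have Hhn : h ^ (n * m) \in H by rewrite memJ_norm // (subsetP (norm_weyl BN)).
have Bhn : h ^ (n * m) \in B by case/setIP: Hhn.
pose x := v ^ n; pose y := (h ^ (n * m) * b') ^ m^-1.
have Euxy : u = x * y.
  apply: (mulgI n); apply: (mulIg m); rewrite E Db /x /y !conjgE.
  by rewrite !invMg !invgK !mulgA mulgV mul1g !(mulgK, mulgKV).
have By : y \in B :^ repr (s i).
  rewrite -(simpleV BN) (conj_weylV sBN nBH (sW i)) memJ_conjg groupM //.
have Uwx : x \in U :^ n by rewrite memJ_conjg.
have Ey : y = x^-1 * u by rewrite Euxy mulKg.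
have By' : y \in B.
  (* If y were in the cell of s_i, then n y would be in that of w s_i; but n y = v^-1 n u is in that
     of w. *)
  have /orP[//|Dy] := conj_simple_cell sBN By.
  have Dny : n * y \in cell w.
    have -> : n * y = v^-1 * n * u.
      by rewrite Ey /x conjgE !invMg !invgK !mulgA mulgV mul1g.
    by rewrite bruhat_cellMr // bruhat_cellMl // groupV (subsetP sUB).
  have := bruhat_cell_inj BN Wws Ww (cell_up _ _ Dn Dy) Dny.
  by move=> Ew; move: up; rewrite Ew ltnn.
have Bx : x \in B by rewrite -(groupMr _ By') -Euxy.
have Ux : x \in U by apply: mem_U_conj Bx Uwx.
have Uy : y \in U by rewrite Ey groupM ?groupV.
exists x, y; split=> //; rewrite inE ?Ux ?Uy //=.
have : y ^ m^-1 \in U.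
  apply: (mem_split_U sBN); first by rewrite -mem_conjg.
  by rewrite p_eltJ (mem_p_elt (split_U sBN)).
by rewrite -mem_conjg.
Qed.

Lemma root_H_norm i : H \subset 'N(X i).
Proof.
apply: normsI nUH _.
by rewrite (norm_conj_weyl sBN) ?nUH ?(weyl_repr BN) ?groupM ?W0 ?sW.
Qed.

Lemma root_subU i : X i \subset U.
Proof. exact: subsetIl. Qed.

Lemma len_longest_simple i : (l w0 = (l (w0 * s i)).+1)%N.
Proof.
apply: (len_simpler_down BN); rewrite ?W0 // (len_simplerP BN) ?W0 //.
by rewrite -leqNgt longest_max // groupM ?W0 ?sW.
Qed.

(** X_i^w is the intersection of U^w and U^(w0 s_i w). Lengths add in the product of w0 s_i w and
    w^-1, since l (w0 s_i) = l w0 - 1. *)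
Lemma root_up i w : w \in W -> (l w < l (s i * w))%N -> X i :^ repr w \subset U.
Proof.
move=> Ww up; apply/subsetP=> x.
have Wsw : s i * w \in W by rewrite groupM ?sW.
have Wws : w0 * s i \in W by rewrite groupM ?W0 ?sW.
rewrite /X conjIg -(conj_weylM sBN nUH) // -mulgA => /setIP[Uwx Ux].
apply: (mem_U_conj _ Uwx).
apply: (@conj_B_additive _ _ _ _ _ _ _ _ sBN (w0 * (s i * w)) w^-1).
- by rewrite groupM ?W0.
- by rewrite groupV.
- rewrite -!mulgA mulgV mulg1 (len_inv BN) // (len_longestl BN) //.
  have Dl := len_simplel_up BN Ww up.
  by apply/eqP; rewrite -eqSS -len_longest_simple -addnS -Dl subnK ?longest_max.
- by apply: subsetP Ux; rewrite conjSg sUB.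
by rewrite invgK; apply: subsetP Uwx; rewrite conjSg sUB.
Qed.

(** [U_factor] for w0 s_i splits U as X_i times [U :&: U :^ repr (s i)]; conjugate by w and use that
    X_i^w is in U. *)
Lemma U_chain i w : w \in W -> (l w < l (s i * w))%N ->
  U :&: U :^ repr w \subset X i :^ repr w * (U :&: U :^ repr (s i * w)).
Proof.
move=> Ww up; apply/subsetP=> x /setIP[Ux]; rewrite mem_conjg => Ux'.
have upi : (l (w0 * s i) < l (w0 * s i * s i))%N.
  by rewrite -mulgA (simple_mulK BN) mulg1 (len_longest_simple i).
have [a [b [Xa /setIP[Ub Usb] E]]] := U_factor (groupM W0 (sW i)) upi Ux'.
have Ex : x = a ^ repr w * b ^ repr w by rewrite -conjMg -E conjgKV.
have Uaw : a ^ repr w \in U by apply: subsetP (root_up Ww up) _ _; rewrite memJ_conjg.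
rewrite Ex mem_mulg ?memJ_conjg // inE (conj_weylM sBN nUH) ?sW //.
by rewrite memJ_conjg Usb andbT -(groupMl _ Uaw) -Ex.
Qed.

(** The conjugate by w0 of [U_chain] for w w0^-1; multiplication by w0^-1 reverses the order of
    lengths. *)
Lemma U_chain_opp i w : w \in W -> (l (s i * w) < l w)%N ->
  U :^ repr w0 :&: U :^ repr w \subset
    X i :^ repr w * (U :^ repr w0 :&: U :^ repr (s i * w)).
Proof.
move=> Ww down; have Wv : w * w0^-1 \in W by rewrite groupM ?groupV ?W0.
have Wsw : s i * w \in W by rewrite groupM ?sW.
have up : (l (w * w0^-1) < l (s i * (w * w0^-1)))%N.
  by rewrite mulgA !(len_longestr BN) // ltn_sub2l // (leq_trans down) ?longest_max.
have W0' : w0 \in W := W0; have W0V : w0^-1 \in W by rewrite groupV.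
have E (A : {set gT}) v : H \subset 'N(A) -> v \in W ->
    (A :^ repr (v * w0^-1)) :^ repr w0 = A :^ repr v.
  by move=> nA Wv'; rewrite -(conj_weylM sBN nA) ?mulgKV // groupM.
have := U_chain Wv up; rewrite -(conjSg _ _ (repr w0)) conjsMg mulgA.
rewrite (conjIg U (U :^ repr (w * w0^-1))).
rewrite (conjIg U (U :^ repr (s i * w * w0^-1))) !E ?nUH ?root_H_norm //.
Qed.

Lemma root_down i w : w \in W -> (l (s i * w) < l w)%N ->
  X i :^ repr w \subset U :^ repr w0.
Proof.
move=> Ww down; have Wv : w * w0^-1 \in W by rewrite groupM ?groupV ?W0.
have Wsw : s i * w \in W by rewrite groupM ?sW.
have up : (l (w * w0^-1) < l (s i * (w * w0^-1)))%N.
  by rewrite mulgA !(len_longestr BN) // ltn_sub2l // (leq_trans down) ?longest_max.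
have := root_up Wv up; rewrite -(conjSg _ _ (repr w0)).
by rewrite -(conj_weylM sBN) ?root_H_norm ?W0 // mulgKV.
Qed.

End RootSubgroups.

(** * U is a Sylow p-subgroup of G *)

Section SylowBorel.

Variables (gT : finGroupType) (G B N U : {group gT}) (p r : nat).
Variable s : 'I_r -> coset_of (B :&: N)%G.
Hypothesis sBN : split_BN_pair G s p U.

Local Notation H := (B :&: N)%G.
Local Notation W := (N / H).
Local Notation l := (weyl_length s).
Local Notation w0 := (longest_elt s).
Local Notation cell := bruhat_cell.
Local Notation BN := (split_BN sBN).
Local Notation sW := (mem_simple BN).
Local Notation X := (simple_root_subgroup s U).

Lemma bruhat_cellM_ex w w' x y : w \in W -> w' \in W ->
  x \in cell w -> y \in cell w' -> exists2 v, v \in W & x * y \in cell v.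
Proof.
move: {2}(l w) (leqnn (l w)) => k.
elim: k => [|k IH] in w x * => lwk Ww Ww' Dx Dy.
  move: lwk Dx; rewrite leqn0 (len_eq0 BN) // => /eqP-> .
  by rewrite (bruhat_cell1 BN) => Bx; exists w'; rewrite // bruhat_cellMl.
have [l0|l_gt0] := posnP (l w); first by apply: IH Dx Dy; rewrite ?l0.
have [i [v [Wv Dw Dl]]] := len_gt0 BN Ww l_gt0.
rewrite Dw in Dx; have [a [b [Da Db ->]]] := bruhat_cell_split BN (sW i) Wv Dx.
have lvk : (l v <= k)%N by rewrite -ltnS -Dl.
have [u Wu Du] := IH v b lvk Wv Ww' Db Dy.
rewrite -mulgA; have /orP[] := bruhat_cellM BN Wu Da Du; last by exists u.
by exists (s i * u); rewrite // groupM ?sW.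
Qed.

Lemma bruhat_cover g : g \in G -> exists2 w, w \in W & g \in cell w.
Proof.
pose Z := [set x | [exists w in W, x \in cell w]].
have ZP x : reflect (exists2 w, w \in W & x \in cell w) (x \in Z).
  by rewrite inE; apply: exists_inP.
have gZ : group_set Z.
  apply/group_setP; split=> [|x y /ZP[w Ww Dx] /ZP[w' Ww' Dy]].
    by apply/ZP; exists 1; rewrite ?group1 // (bruhat_cell1 BN).
  by apply/ZP; apply: bruhat_cellM_ex Dx Dy.
move=> Gg; apply/ZP; apply: subsetP g Gg.
rewrite -(BN_gen BN) /joing -[Z]/(gval (Group gZ)) gen_subG subUset.
apply/andP; split; apply/subsetP=> x Bx; apply/ZP.
  by exists 1; rewrite ?group1 // (bruhat_cell1 BN).
by exists (coset H x); rewrite ?mem_coset_weyl // (bruhat_cell_rep BN).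
Qed.

Lemma split_B_sub : B \subset G.
Proof. by rewrite -(BN_gen BN) joing_subl. Qed.

Lemma split_N_sub : N \subset G.
Proof. by rewrite -(BN_gen BN) joing_subr. Qed.

Lemma split_U_sub : U \subset G.
Proof. exact: subset_trans (normal_sub (split_U_normal sBN)) split_B_sub. Qed.

Lemma conj_U_simple_neq i : ~~ (U \subset U :^ repr (s i)).
Proof.
have Ns := weyl_repr BN (sW i); apply: contra (BN_neq BN Ns (coset_reprK _)).
have [_ <- _ _] := sdprodP (split_B sBN).
rewrite conjsMg (normP (subsetP (norm_weyl BN) _ Ns)) => sUU.
suff -> : U :^ repr (s i) = U by [].
by apply/esym/eqP; rewrite eqEcard sUU cardJg leqnn.
Qed.

(** Otherwise [U_factor] for w0 s_i would put U inside U^s_i, and s_i would normalise B. *)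
Lemma simple_root_subgroup_neq1 i : X i != 1.
Proof.
apply: contra (conj_U_simple_neq i) => /eqP X1; apply/subsetP=> u Uu.
have W0 := longest_mem s.
have upi : (l (w0 * s i) < l (w0 * s i * s i))%N.
  by rewrite -mulgA (simple_mulK BN) mulg1 (len_longest_simple sBN i).
have [a [c [Xa /setIP[_ Uc] ->]]] := U_factor sBN (groupM W0 (sW i)) upi Uu.
by move: Xa; rewrite -[_ :&: _]/(X i) X1 => /set1P->; rewrite mul1g.
Qed.

(** A normalising element in the cell of w gives U^w = U. If w is not 1, a left descent i of w puts
    X_i^w inside both U and U^w0, so it is trivial. *)
Lemma normU_sub : 'N_G(U) \subset B.
Proof.
apply/subsetP=> x /setIP[Gx nUx]; have [w Ww Dx] := bruhat_cover Gx.
have [n Nn Dn] := weyl_rep Ww; move: Dx; rewrite -{1}Dn => /(bruhat_cellP BN)[] //.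
move=> b [b' [Bb Bb' Ex]]; have nUB := normal_norm (split_U_normal sBN).
have nUw : U :^ repr w = U.
  rewrite -Dn (conj_weyl sBN (split_H_norm sBN)) //; apply: normP.
  by move: nUx; rewrite Ex groupMr ?groupMl // (subsetP nUB).
have [l0|l_gt0] := posnP (l w).
  move/eqP: l0; rewrite (len_eq0 BN) // -Dn => /eqP/coset_idr Hn.
  have /setIP[Bn _] : n \in H by apply: Hn; rewrite (subsetP (norm_weyl BN)).
  by rewrite Ex !groupM.
have [i [v [Wv Dw Dl]]] := len_gt0 BN Ww l_gt0.
have Ev : s i * w = v by rewrite Dw (simpleK BN).
have down : (l (s i * w) < l w)%N by rewrite Ev Dl.
case/eqP: (simple_root_subgroup_neq1 i).
apply: (@conjsg_inj _ (repr w)); rewrite conjs1g; apply/trivgP.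
rewrite -(tiU_longest sBN) subsetI (root_down sBN) // andbT.
have : X i :^ repr w \subset U :^ repr w by rewrite conjSg root_subU.
by rewrite nUw.
Qed.

(** Normalisers grow in p-groups: a larger p-subgroup would have a p-element outside U normalising
    U, hence lying in B. *)
Lemma split_U_Sylow : p.-Sylow(G) U.
Proof.
have [S sylS sUS] := Sylow_superset split_U_sub (split_U sBN).
have [pS sSG] := (pHall_pgroup sylS, pHall_sub sylS).
suff -> : U = S :> {group gT} by [].
apply/val_inj/eqP; rewrite /= eqEproper sUS /=; apply/negP=> prUS.
have /properP[_ [x]] := nilpotent_proper_norm (pgroup_nil pS) prUS.
case/setIP=> Sx nUx /negP[]; apply: (mem_split_U sBN).
  by rewrite (subsetP normU_sub) // inE nUx (subsetP sSG).
exact: mem_p_elt pS Sx.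
Qed.

End SylowBorel.

(** * The geometric representation *)

Section GeometricRepresentation.

Variables (gT : finGroupType) (G B N : {group gT}) (r : nat).
Variable s : 'I_r -> coset_of (B :&: N)%G.
Hypothesis BN : BN_pair G s.
Variable R : realType.

Local Notation H := (B :&: N)%G.
Local Notation W := (N / H)%g.
Local Notation l := (weyl_length s).
Local Notation we := (word_elt s).
Local Notation act := (@word_act _ _ _ _ s R).
Local Notation refl := (@simple_reflection _ _ _ _ s R).
Local Notation root := (@simple_root r R).
Local Notation gram := (gram s R).

Local Open Scope ring_scope.

Definition simple_angle (x y : 'I_r) : R := pi / #[(s x * s y)%g]%:R.

Lemma simple_angleC x y : simple_angle x y = simple_angle y x.
Proof. by rewrite /simple_angle -orderV invMg !(simpleV BN). Qed.

Lemma simple_order_gt1 x y : x != y -> (1 < #[(s x * s y)%g])%N.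
Proof.
move=> nxy; rewrite order_gt1; apply: contra nxy => /eqP E.
apply/eqP/(BN_distinct BN); rewrite -[LHS]mulg1 -(simple_mulK BN y) mulgA E.
by rewrite mul1g.
Qed.

Lemma simple_angle_gt0 x y : 0 < simple_angle x y.
Proof. by rewrite divr_gt0 ?pi_gt0 ?ltr0n ?order_gt0. Qed.

Lemma sin_simple_angle_gt0 x y : x != y -> 0 < sin (simple_angle x y).
Proof.
move=> nxy; apply: sin_gt0_pi; rewrite simple_angle_gt0 /=.
rewrite ltr_pdivrMr ?ltr0n ?order_gt0 // ltr_pMr ?pi_gt0 //.
by rewrite ltr1n simple_order_gt1.
Qed.

Lemma gramE x y : gram x y = - cos (simple_angle x y).
Proof. by rewrite mxE. Qed.

Lemma root_gram x y : (root x *m gram) 0 y = gram x y.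
Proof. by rewrite -rowE mxE. Qed.

Lemma gram_diag x : gram x x = 1.
Proof.
by rewrite gramE /simple_angle (simple_mulK BN) order1 divr1 cospi opprK.
Qed.

Lemma refl_linear x c u v : refl x (c *: u + v) = c *: refl x u + refl x v.
Proof.
rewrite /simple_reflection mulmxDl -scalemxAl !mxE scalerBr scalerA.
rewrite mulrDr scalerDl opprD mulrCA -!addrA; congr (_ + _).
by rewrite addrCA.
Qed.

Lemma reflZ x c u : refl x (c *: u) = c *: refl x u.
Proof.
rewrite -[c *: u]addr0 refl_linear -[RHS]addr0; congr (_ + _).
by rewrite /simple_reflection mul0mx mxE mulr0 scale0r subr0.
Qed.

Lemma reflD x u v : refl x (u + v) = refl x u + refl x v.
Proof. by rewrite -[u in LHS]scale1r refl_linear scale1r. Qed.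

Lemma refl_self x : refl x (root x) = - root x.
Proof.
rewrite /simple_reflection root_gram gram_diag mulr1 scaler_nat mulr2n opprD.
by rewrite addrA subrr add0r.
Qed.

Lemma refl_root x y : refl x (root y) =
  root y + (2 * cos (simple_angle x y)) *: root x.
Proof.
by rewrite /simple_reflection root_gram gramE mulrN scaleNr opprK simple_angleC.
Qed.

Lemma refl_fix x v : (v *m gram) 0 x = 0 -> refl x v = v.
Proof. by rewrite /simple_reflection => ->; rewrite mulr0 scale0r subr0. Qed.

Lemma reflK x v : refl x (refl x v) = v.
Proof.
rewrite {2}/simple_reflection -scaleNr addrC refl_linear refl_self.
by rewrite /simple_reflection scalerN scaleNr opprK addrC subrK.
Qed.

Lemma word_act_cat t1 t2 v : act (t1 ++ t2) v = act t1 (act t2 v).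
Proof. exact: foldr_cat. Qed.

Lemma word_act_rcons t i v : act (rcons t i) v = act t (refl i v).
Proof. exact: foldr_rcons. Qed.

Lemma word_act_linear t c u v : act t (c *: u + v) = c *: act t u + act t v.
Proof. by elim: t => //= i t ->; rewrite refl_linear. Qed.

Lemma word_act0 t : act t 0 = 0.
Proof.
have := word_act_linear t 1 0 0; rewrite !scale1r addr0 => /eqP.
by rewrite -{1}[act t 0]addr0 (inj_eq (addrI _)) eq_sym => /eqP.
Qed.

Lemma word_actD t u v : act t (u + v) = act t u + act t v.
Proof. by have := word_act_linear t 1 u v; rewrite !scale1r. Qed.

Lemma word_actZ t c v : act t (c *: v) = c *: act t v.
Proof. by have := word_act_linear t c v 0; rewrite word_act0 !addr0. Qed.

Lemma word_actN t v : act t (- v) = - act t v.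
Proof. by rewrite -scaleN1r word_actZ scaleN1r. Qed.

Lemma word_act_sum t (I : Type) (e : seq I) (P : pred I) F :
  act t (\sum_(i <- e | P i) F i) = \sum_(i <- e | P i) act t (F i).
Proof.
elim: e => [|i e IH]; first by rewrite !big_nil word_act0.
by rewrite !big_cons; case: (P i); rewrite ?word_actD IH.
Qed.

Lemma word_act_revK t v : act (rev t) (act t v) = v.
Proof.
by elim: t v => [|i t IH] v //=; rewrite rev_cons word_act_rcons reflK IH.
Qed.

Lemma word_actKrev t v : act t (act (rev t) v) = v.
Proof. by rewrite -{1}(revK t) word_act_revK. Qed.

Fixpoint alternating (x y : 'I_r) (k : nat) : seq 'I_r :=
  if k is k'.+1 then x :: alternating y x k' else [::].

Lemma size_alternating x y k : size (alternating x y k) = k.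
Proof. by elim: k x y => //= k IH x y; rewrite IH. Qed.

Lemma alternating_rcons x y k :
  alternating x y k.+1 = rcons (alternating x y k) (if odd k then y else x).
Proof.
elim: k x y => // k IH x y; rewrite -[LHS]/(x :: alternating y x k.+1) IH /=.
by case: (odd k).
Qed.

Lemma take_alternating x y a b :
  take a (alternating x y (a + b)) = alternating x y a.
Proof. by elim: a x y => [|a IH] x y /=; rewrite ?take0 ?IH. Qed.

(** Turns equality of the two alternating products into divisibility of k by the order of s_x
    s_y. *)
Lemma word_elt_alternatingV x y k :
  (we (alternating x y k) * (we (alternating y x k))^-1 = (s x * s y) ^+ k)%g.
Proof.
elim: k x y => [|k IH] x y /=; first by rewrite word_elt_nil mulgV.
rewrite !word_elt_cons invMg (simpleV BN) !mulgA -(mulgA (s x)) IH.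
elim: k {IH} => [|k IH]; first by rewrite mulg1 expg1.
by rewrite [in LHS]expgSr [RHS]expgSr -IH !mulgA.
Qed.

Lemma iter_comp_shift (T : Type) (f g : T -> T) k v :
  f (iter k (g \o f) (g v)) = iter k.+1 (f \o g) v.
Proof. by elim: k => // k IH; rewrite iterS [RHS]iterS -IH. Qed.

Lemma iter_cancel (T : Type) (f g : T -> T) k : cancel g f ->
  cancel (iter k g) (iter k f).
Proof.
by move=> gK; elim: k => [//|k IH] v; rewrite iterSr iterS gK IH.
Qed.

Lemma word_act_alternating_rev x y k v :
  act (alternating x y k) (act (rev (alternating y x k)) v)
    = iter k (refl x \o refl y) v.
Proof.
elim: k x y v => [//|k IH] x y v.
rewrite [alternating y x _]/= rev_cons word_act_rcons -iter_comp_shift -IH.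
exact: erefl.
Qed.

Lemma word_act_alternating_double x y k v :
  act (alternating x y k.*2) v = iter k (refl x \o refl y) v.
Proof.
elim: k v => [|k IH] v; first exact: erefl.
by rewrite doubleS -[LHS]/(refl x (refl y (act _ v))) IH.
Qed.

(** The addition formula for the sine, scaled to avoid division. The root on the left is that of the
    next letter of the alternating word. *)
Lemma alternating_root x y k :
  sin (simple_angle x y) *:
    act (alternating x y k) (root (if odd k then y else x))
  = sin (k.+1%:R * simple_angle x y) *: root x
    + sin (k%:R * simple_angle x y) *: root y.
Proof.
set th := simple_angle x y; elim: k x y @th => [|k IH] x y th.
  by rewrite /= mul1r mul0r sin0 scale0r addr0.
have E := IH y x; rewrite simple_angleC -/th in E.
rewrite -[act _ _]/(refl x (act (alternating y x k) _)) -reflZ.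
rewrite -[odd k.+1]/(~~ odd k) if_neg E.
rewrite reflD !reflZ refl_self refl_root -/th scalerDr scalerA scalerN.
rewrite -addrA -scaleNr -scalerDl addrC; congr (_ *: _ + _).
rewrite -[k.+2%:R]natr1 (_ : k%:R = k.+1%:R - 1); last by rewrite -natr1 addrK.
set t := k.+1%:R; have -> : (t + 1) * th = t * th + th by ring.
have -> : (t - 1) * th = t * th - th by ring.
rewrite !sinD sinN cosN; ring.
Qed.

Lemma dihedral_root x y : x != y ->
  iter #[(s x * s y)%g] (refl x \o refl y) (root x) = root x.
Proof.
move=> nxy; set m := #[_]; apply: (scalerI (lt0r_neq0 (sin_simple_angle_gt0 nxy))).
have := alternating_root x y m.*2.
rewrite odd_double word_act_alternating_double => ->.
have Em : m%:R * simple_angle x y = pi :> R.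
  by rewrite /simple_angle -/m mulrC divfK // pnatr_eq0 -lt0n order_gt0.
have -> : (m.*2)%:R * simple_angle x y = pi + pi.
  by rewrite -addnn natrD mulrDl Em.
have -> : (m.*2).+1%:R * simple_angle x y = simple_angle x y + pi + pi.
  by rewrite -natr1 -addnn natrD !mulrDl Em mul1r addrC addrA.
by rewrite !sinDpi opprK sinpi oppr0 scale0r addr0.
Qed.

Lemma iter_reflP x y k : exists t, forall v, iter k (refl x \o refl y) v = act t v.
Proof.
by exists (alternating x y k.*2) => v; rewrite word_act_alternating_double.
Qed.

Lemma dihedral_relation x y v : x != y ->
  iter #[(s x * s y)%g] (refl x \o refl y) v = v.
Proof.
move=> nxy; set m := #[_]; have [t Et] := iter_reflP x y m.
have Ex : act t (root x) = root x by rewrite -Et dihedral_root.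
(* Exchanging x and y gives the inverse rotation, which therefore fixes [root y]. *)
have Ey : act t (root y) = root y.
  have nyx : y != x by rewrite eq_sym.
  have := dihedral_root nyx; rewrite -orderV invMg !(simpleV BN) -/m => E.
  rewrite -Et -{1}E; apply: iter_cancel => u.
  by rewrite /= !reflK.
(* The coefficients c and c' solve the 2 by 2 Gram system, whose determinant d is the square of the
   sine of the angle; w is then orthogonal to both roots and fixed by both reflections. *)
pose g := gram x y; pose d := 1 - g ^+ 2.
have d0 : d != 0.
  rewrite /d /g gramE sqrrN -[1](cos2Dsin2 (simple_angle x y)) addrC addKr.
  by rewrite expf_neq0 // lt0r_neq0 ?sin_simple_angle_gt0.
have gC : gram y x = g by rewrite /g !gramE simple_angleC.
pose A := (v *m gram) 0 x; pose A' := (v *m gram) 0 y.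
pose c := (A - g * A') / d; pose c' := (A' - g * A) / d.
pose w := v - (c *: root x + c' *: root y).
have wE z : (w *m gram) 0 z = (v *m gram) 0 z - (c * gram x z + c' * gram y z).
  rewrite -!root_gram mulmxBl mulmxDl -!scalemxAl.
  move: (v *m _) (root x *m _) (root y *m _) => a b e; by rewrite !mxE.
have wx : refl x w = w.
  by apply: refl_fix; rewrite wE gram_diag gC -/A /c /c' /d; field; apply: d0.
have wy : refl y w = w.
  by apply: refl_fix; rewrite wE gram_diag -/g -/A' /c /c' /d; field; apply: d0.
have Ew : act t w = w.
  rewrite -Et; elim: m {Et Ex Ey} => //= m ->; by rewrite wy wx.
rewrite Et -[v](subrK (c *: root x + c' *: root y)) -/w.
by rewrite word_actD Ew word_actD !word_actZ Ex Ey.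
Qed.

Lemma word_act_braid x y k v : x != y ->
    we (alternating x y k) = we (alternating y x k) ->
  act (alternating x y k) v = act (alternating y x k) v.
Proof.
move=> nxy E; have := word_elt_alternatingV x y k; rewrite E mulgV => /esym/eqP.
rewrite -order_dvdn => /dvdnP[q Dk].
rewrite -{1}(word_act_revK (alternating y x k) v) word_act_alternating_rev.
rewrite {1}Dk; elim: q {E Dk} => [|q IH]; first exact: erefl.
by rewrite mulSn iterD IH dihedral_relation.
Qed.

Definition reduced t := l (we t) == size t.

Lemma reduced_cat t1 t2 : reduced (t1 ++ t2) -> reduced t1 && reduced t2.
Proof. by move/eqP/(word_eltI BN) => [E1 E2]; rewrite /reduced E1 E2 !eqxx. Qed.

Lemma alternating_reduced x y t : x != y ->
    all (mem [:: x; y]) t -> reduced t ->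
  t = alternating x y (size t) \/ t = alternating y x (size t).
Proof.
move=> nxy; elim: t => [|z t IH]; first by left.
case/andP=> /= Dz At Dt; have /andP[_ Dt'] := @reduced_cat [:: z] t Dt.
have nozz u : t = z :: u -> False.
  move=> Et; have := len_word s u.
  move: Dt; rewrite Et /reduced !word_elt_cons mulgA (simple_mulK BN) mul1g.
  by move=> /eqP->; rewrite /= ltnNge leqnSn.
have [Et|Et] := IH At Dt'; case: (size t) Et => [|k] Et; rewrite Et;
  move: Dz; rewrite !inE => /orP[] /eqP Ez; rewrite Ez; do ?[by left | by right];
  by case: (nozz _ (etrans Et (congr1 (cons^~ _) (esym Ez)))).
Qed.

(** Exchange for y deletes a letter. If it is in the tail c, the alternating prefix gains a letter
    and the tail loses one; if it is in the prefix, a second reduced word in x and y for the same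
    element results, and it must be the other alternating word. *)
Lemma braid_of_descents x y c k w : x != y -> (0 < k)%N ->
    we (alternating x y k ++ c) = w -> (k + size c)%N = l w ->
    (l (s x * w) < l w)%N -> (l (s y * w) < l w)%N ->
  exists k' c', [/\ (0 < k')%N, we (alternating x y k' ++ c') = w,
    (k' + size c')%N = l w & we (alternating x y k') = we (alternating y x k')].
Proof.
have [n] := ubnP (size c); elim: n => [//|n IH] in x y c k *.
rewrite ltnS => lec nxy k0 Ew Dl dx dy.
rewrite -Ew in dy; have [t1 [j [t2 [Et Ed]]]] := exchange_word BN dy.
have Ea : take (size t1) (alternating x y k ++ c) = t1.
  by rewrite Et take_size_cat.
have Eb : drop (size t1) (alternating x y k ++ c) = j :: t2.
  by rewrite Et drop_size_cat.
move: Ea Eb; rewrite take_cat drop_cat size_alternating.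
case: ltnP => [ltk|lek] Ea Eb; last first.
  set m := (size t1 - k)%N in Ea Eb.
  have Dc : size c = (size (take m c ++ t2)).+1.
    by rewrite -{1}(cat_take_drop m c) Eb !size_cat /= addnS.
  have [||||||| k' [c' [k'0 Ew' Dl' Ebr]]] := IH y x (take m c ++ t2) k.+1.
  - by rewrite -Dc.
  - by rewrite eq_sym.
  - by [].
  - rewrite -Ew /= word_elt_cons catA Ea -Ed; exact: (simpleK BN).
  - by rewrite addSnnS -Dc.
  - by rewrite -Ew.
  - by [].
  exists k', c'; split=> //.
  by rewrite word_elt_cat -Ebr -word_elt_cat.
case Ed2: (drop (size t1) (alternating x y k)) Eb => [|j' t3] Eb.
  have := size_drop (size t1) (alternating x y k).
  by rewrite Ed2 size_alternating => /esym/eqP; rewrite subn_eq0 leqNgt ltk.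
case: Eb => _ Et2; exists k, c; split=> //.
have Dk : k = size (y :: t1 ++ t3).
  rewrite -[LHS](size_alternating x y) -(cat_take_drop (size t1) (alternating x y k)).
  by rewrite Ed2 Ea /= !size_cat /= addnS.
have Ey : (s y * we (alternating x y k) = we (t1 ++ t3))%g.
  apply: (mulIg (we c)); rewrite -mulgA -!word_elt_cat Ed -Et2 catA.
  by [].
have Ek : we (y :: t1 ++ t3) = we (alternating x y k).
  by rewrite word_elt_cons -Ey (simpleK BN).
have red : reduced (y :: t1 ++ t3).
  suff: reduced ((y :: t1 ++ t3) ++ c) by case/reduced_cat/andP.
  by rewrite /reduced word_elt_cat Ek -word_elt_cat Ew size_cat -Dk Dl.
have Aall z z' q : all (mem [:: z; z']) (alternating z z' q).
  elim: q z z' => //= q IHq z z'; rewrite !inE eqxx /=.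
  by apply: sub_all (IHq z' z) => u; rewrite !inE orbC.
have Ay : all (mem [:: x; y]) (y :: t1 ++ t3).
  have := Aall x y k; rewrite -{1}(cat_take_drop (size t1) (alternating x y k)).
  by rewrite Ed2 Ea /= !all_cat /= !inE eqxx orbT /= => /and3P[-> _ ->].
have [E|E] := alternating_reduced nxy Ay red; rewrite -Dk in E; last first.
  by rewrite -E Ek.
by move: E k0; case: (k) => // k1 [] /eqP; rewrite eq_sym (negPf nxy).
Qed.

(** Matsumoto's argument. If the first letters x and y differ, both are left descents, and
    [braid_of_descents] gives reduced words beginning with x and with y that differ by a braid move;
    induction links t and t' to these. *)
Lemma word_act_reduced t t' v : reduced t -> reduced t' -> we t = we t' ->
  act t v = act t' v.
Proof.
have [n] := ubnP (size t); elim: n => [//|n IH] in t t' v *.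
rewrite ltnS => let' /eqP Dt /eqP Dt' E.
have Est : size t = size t' by rewrite -Dt -Dt' E.
case: t let' Dt E Est => [|x a] let' Dt E Est.
  by case: t' Est {Dt' E}.
case: t' Dt' E Est => [//|y b] Dt' E [Est].
have /andP[_ redb] := @reduced_cat [:: y] b (introT eqP Dt').
have /andP[_ reda] := @reduced_cat [:: x] a (introT eqP Dt).
have [Exy|nxy] := eqVneq x y.
  rewrite -Exy /= (IH a b) //.
  by apply: (mulgI (s x)); rewrite -!word_elt_cons E Exy.
have dx : (l (s x * we (x :: a)) < l (we (x :: a)))%N.
  by rewrite Dt word_elt_cons (simpleK BN) //= ltnS (eqP reda).
have dy : (l (s y * we (x :: a)) < l (we (x :: a)))%N.
  by rewrite Dt E word_elt_cons (simpleK BN) //= ltnS (eqP redb) Est.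
have [//|||//|//|k [c [k0 Ew Dl Ebr]]] :=
  @braid_of_descents x y a 1 (we (x :: a)) nxy.
- by [].
- by rewrite Dt.
have red1 : reduced (alternating x y k ++ c).
  by rewrite /reduced Ew -Dl size_cat size_alternating.
have red2 : reduced (alternating y x k ++ c).
  rewrite /reduced word_elt_cat -Ebr -word_elt_cat Ew -Dl.
  by rewrite size_cat size_alternating.
have step z u u' : (size u < n)%N -> reduced (z :: u) -> reduced (z :: u') ->
    we (z :: u) = we (z :: u') -> act (z :: u) v = act (z :: u') v.
  move=> su ru ru' Eu; have /andP[_ ru1] := @reduced_cat [:: z] u ru.
  have /andP[_ ru1'] := @reduced_cat [:: z] u' ru'.
  rewrite /= (IH u u') //; apply: (mulgI (s z)); by rewrite -!word_elt_cons.
case: k k0 Ew Dl Ebr red1 red2 => // k _ Ew Dl Ebr red1 red2.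
rewrite (step x a (alternating y x k ++ c)) //; first last.
- exact/eqP.
rewrite [RHS](step y b (alternating x y k ++ c)) -?Est //; first last.
- by rewrite -E -Ew -[_ :: _]/(alternating y x k.+1 ++ c) !word_elt_cat Ebr.
- exact/eqP.
by rewrite -!cat_cons !word_act_cat; apply: (word_act_braid (k := k.+1)).
Qed.

Lemma reduced_word_act t : exists t',
  [/\ reduced t', we t' = we t & forall v, act t' v = act t v].
Proof.
elim: t => [|x t [t' [red Ew Ea]]].
  by exists [::]; rewrite /reduced word_elt_nil len1.
have [up|] := boolP (l (we t) < l (s x * we t))%N.
  exists (x :: t'); split=> [||v]; rewrite ?word_elt_cons ?Ew //=; last first.
    by rewrite Ea.
  rewrite /reduced word_elt_cons Ew (len_simplel_up BN) ?(mem_word BN) //.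
  by rewrite -Ew (eqP red).
rewrite -(len_simplelP BN) ?(mem_word BN) // => down.
have Ws : (s x * we t)%g \in W by rewrite groupM ?(mem_simple BN) ?(mem_word BN).
have [u Eu Du] := reduced_word BN Ws; exists u; split.
- by rewrite /reduced Eu Du.
- by rewrite word_elt_cons.
(* The word x :: u is reduced with the product of t, so it acts as t does, and the two reflections
   in x cancel. *)
move=> v; rewrite /= -Ea -(@word_act_reduced (x :: u) t') //= ?reflK //.
  rewrite /reduced word_elt_cons Eu (simpleK BN).
  by rewrite (len_simplel_down BN _ down) ?(mem_word BN) //= Du.
by rewrite word_elt_cons Eu (simpleK BN).
Qed.

Lemma eq_word_act t t' v : we t = we t' -> act t v = act t' v.
Proof.
move=> E; have [u [ru Eu <-]] := reduced_word_act t.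
have [u' [ru' Eu' <-]] := reduced_word_act t'.
by apply: word_act_reduced; rewrite // Eu Eu'.
Qed.

End GeometricRepresentation.

(** * Signs of roots *)

Section Positivity.

Variables (gT : finGroupType) (G B N : {group gT}) (r : nat).
Variable s : 'I_r -> coset_of (B :&: N)%G.
Hypothesis BN : BN_pair G s.
Variable R : realType.

Local Notation H := (B :&: N)%G.
Local Notation W := (N / H)%g.
Local Notation l := (weyl_length s).
Local Notation we := (word_elt s).
Local Notation act := (@word_act _ _ _ _ s R).
Local Notation root := (@simple_root r R).
Local Notation sW := (mem_simple BN).

Local Open Scope ring_scope.

(** Strip letters i and j from the right as long as this shortens w. *)
Lemma dihedral_decomposition i j w : w \in W -> exists v c,
  [/\ v \in W, all (mem [:: i; j]) c, w = (v * we c)%g,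
      l w = (l v + size c)%N & (l v < l (v * s i)%g)%N /\ (l v < l (v * s j)%g)%N].
Proof.
have [n] := ubnP (l w); elim: n => [//|n IH] in w *; rewrite ltnS => lwn Ww.
have step k : k \in [:: i; j] -> (l (w * s k)%g < l w)%N -> exists v c,
  [/\ v \in W, all (mem [:: i; j]) c, w = (v * we c)%g,
      l w = (l v + size c)%N & (l v < l (v * s i)%g)%N /\ (l v < l (v * s j)%g)%N].
  move=> ik down; have Wwk : (w * s k)%g \in W by rewrite groupM ?sW.
  have [v [c [Wv Ac Ew El up]]] := IH _ (leq_trans down lwn) Wwk.
  exists v, (rcons c k); rewrite all_rcons /= ik Ac; split=> //.
    by rewrite word_elt_rcons mulgA -Ew -mulgA (simple_mulK BN) mulg1.
  by rewrite size_rcons addnS -El; apply: (len_simpler_down BN).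
have [upi|] := boolP (l w < l (w * s i)%g)%N; last first.
  by rewrite -(len_simplerP BN) //; apply: step; rewrite mem_head.
have [upj|] := boolP (l w < l (w * s j)%g)%N; last first.
  by rewrite -(len_simplerP BN) //; apply: step; rewrite !inE eqxx orbT.
by exists w, [::]; rewrite word_elt_nil mulg1 addn0.
Qed.

(** Beyond the order m, the braid relation rewrites the first m + 1 letters as a word beginning with
    a repeated letter. *)
Lemma alternating_reduced_le x y k :
  reduced s (alternating x y k) -> (k <= #[(s x * s y)%g])%N.
Proof.
move=> red; set m := #[_]; rewrite leqNgt; apply/negP=> ltmk.
have Em : we (alternating x y m) = we (alternating y x m).
  have := word_elt_alternatingV BN x y m; rewrite expg_order => /eqP.
  by rewrite -eq_mulgV1 => /eqP.
have : reduced s (alternating x y m.+1).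
  move: red; rewrite -(subnKC ltmk).
  rewrite -(cat_take_drop m.+1 (alternating _ _ _)) take_alternating.
  by case/(reduced_cat BN)/andP.
have m0 : (0 < m)%N := order_gt0 _.
rewrite /reduced size_alternating /= word_elt_cons -Em -(prednK m0) /=.
rewrite word_elt_cons (simpleK BN) => /eqP Dl.
have := len_word s (alternating y x m.-1).
by rewrite Dl size_alternating ltnNge leqnSn.
Qed.

Definition nonneg (v : 'rV[R]_r) := forall j, 0 <= v 0 j.

Lemma nonneg_root i : nonneg (root i).
Proof. by move=> j; rewrite mxE; case: (_ && _); rewrite ?ler01. Qed.

Lemma nonneg_comb a b u v : 0 <= a -> 0 <= b -> nonneg u -> nonneg v ->
  nonneg (a *: u + b *: v).
Proof.
by move=> a0 b0 u0 v0 j; rewrite !mxE addr_ge0 // mulr_ge0.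
Qed.

Lemma alternating_root_nonneg x y k : x != y -> reduced s (alternating x y k.+1) ->
  exists a b, [/\ 0 <= a, 0 <= b &
    act (alternating x y k) (root (if odd k then y else x))
      = a *: root x + b *: root y].
Proof.
move=> nxy red; have lekm := alternating_reduced_le red.
have s0 := sin_simple_angle_gt0 BN R nxy; set th := simple_angle s R x y in s0.
(* As k + 1 is at most the order of s_x s_y, these angles do not exceed pi. *)
have sin_ge0 q : (q <= k.+1)%N -> 0 <= sin (q%:R * th).
  move=> leq; apply: sin_ge0_pi.
  rewrite mulr_ge0 ?ler0n ?(ltW (simple_angle_gt0 _ _ _ _)) //=.
  rewrite /th /simple_angle mulrCA ger_pMr ?pi_gt0 //.
  rewrite ler_pdivrMr ?ltr0n ?order_gt0 // mul1r ler_nat.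
  exact: leq_trans leq lekm.
exists (sin (k.+1%:R * th) / sin th), (sin (k%:R * th) / sin th).
split; rewrite ?divr_ge0 ?sin_ge0 ?(ltW s0) //.
apply: (scalerI (lt0r_neq0 s0)).
rewrite (alternating_root BN R x y k) -/th scalerDr !scalerA.
by rewrite ![sin th * _]mulrC !divfK ?lt0r_neq0.
Qed.

(* Humphreys, Reflection groups and Coxeter groups, Theorem 5.4. *)
Lemma word_act_nonneg t i : (l (we t) < l (we t * s i)%g)%N ->
  nonneg (act t (root i)).
Proof.
have [n] := ubnP (l (we t)); elim: n => [//|n IH] in t i *.
rewrite ltnS => let_n up; have Wt := mem_word BN t.
have [l0|l_gt0] := posnP (l (we t)).
  move/eqP: l0; rewrite (len_eq0 BN) // => /eqP E.
  rewrite (eq_word_act BN (t' := [::])) ?word_elt_nil //; exact: nonneg_root.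
have [j down] : exists j, (l (we t * s j)%g < l (we t))%N.
  have l0' : (0 < l (we t)^-1%g)%N by rewrite (len_inv BN).
  have Wt' : (we t)^-1%g \in W by rewrite groupV.
  have [j [v [_ Ev El]]] := len_gt0 BN Wt' l0'.
  exists j; rewrite (len_simpler BN) // -(len_inv BN Wt) Ev (simpleK BN).
  by rewrite -Ev El.
have nij : i != j.
  by apply: contraTneq down => <-; rewrite -leqNgt ltnW.
(* The factor v is shorter than the product of t because c is not empty, so by induction it keeps
   both simple roots nonnegative. As [rcons c i] is reduced, c sends [root i] to a nonnegative
   combination of these two. *)
have [v [c [Wv Ac Ew El [upi upj]]]] := dihedral_decomposition i j Wt.
have c0 : (0 < size c)%N.
  rewrite lt0n size_eq0; apply: contraTneq down => c0.
  by rewrite Ew c0 word_elt_nil mulg1 -leqNgt ltnW.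
have lvn : (l v < n)%N.
  by apply: leq_trans let_n; rewrite El -addn1 leq_add2l.
have [tv Etv Dtv] := reduced_word BN Wv.
have posi : nonneg (act tv (root i)) by apply: IH; rewrite Etv.
have posj : nonneg (act tv (root j)) by apply: IH; rewrite Etv.
rewrite (eq_word_act BN (t' := tv ++ c)); last by rewrite word_elt_cat Etv.
rewrite word_act_cat.
have red : reduced s (rcons c i).
  have Wc := mem_word BN c.
  rewrite /reduced eqn_leq len_word size_rcons /= word_elt_rcons.
  rewrite -(leq_add2l (l v)) addnS -El.
  apply: leq_trans up _; rewrite Ew -mulgA.
  by apply: (len_mul BN); rewrite // groupM ?sW.
have Aci : all (mem [:: i; j]) (rcons c i) by rewrite all_rcons /= mem_head.
have := alternating_reduced BN nij Aci red; rewrite size_rcons => cE.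
have [x [y [nxy posx posy E]]] : exists x y, [/\ x != y, nonneg (act tv (root x)),
    nonneg (act tv (root y)) & rcons c i = alternating x y (size c).+1].
  by case: cE => E; [exists i, j | exists j, i]; rewrite // eq_sym.
rewrite E in red; have [a [b [a0 b0 Eab]]] := alternating_root_nonneg nxy red.
move: E; rewrite alternating_rcons => /rcons_inj[Ec Ei].
rewrite Ec {1}Ei Eab word_actD !word_actZ; exact: nonneg_comb.
Qed.

Lemma word_act_nonpos t i : (l (we t * s i)%g < l (we t))%N ->
  nonneg (- act t (root i)).
Proof.
move=> down; have -> : - act t (root i) = act (rcons t i) (root i).
  by rewrite word_act_rcons (refl_self BN) word_actN.
apply: word_act_nonneg; rewrite word_elt_rcons -mulgA (simple_mulK BN) mulg1.
exact: down.
Qed.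

End Positivity.

(** * The Levi decomposition *)

(* If Q = A :&: 'N(V), then Q (S :&: L) V is a p-group containing the Sylow
   subgroup S, so that Q \subset S. *)
Lemma tiI_norm_Sylow (gT : finGroupType) (p : nat) (G A V L S : {group gT}) :
    p.-Sylow(G) S -> p.-group A -> A \subset G -> L \subset 'N(A) ->
    L \subset 'N(V) -> V \subset S -> S \subset V * L -> A :&: S = 1 ->
  A :&: 'N(V) = 1.
Proof.
move=> sylS pA sAG nAL nVL sVS sSVL tiAS; have pS := pHall_pgroup sylS.
pose Q := (A :&: 'N(V))%G; pose D := (L :&: S)%G.
have nQD : D \subset 'N(Q).
  apply: normsI; first exact: subset_trans (subsetIl _ _) nAL.
  by apply: subset_trans (subsetIl _ _) (subset_trans nVL (normG _)).
have pE : p.-group (Q <*> D)%G.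
  rewrite /= norm_joinEr // pgroupM (pgroupS (subsetIl _ _) pA).
  exact: pgroupS (subsetIr _ _) pS.
have nVE : (Q <*> D)%G \subset 'N(V).
  by rewrite join_subG subsetIr (subset_trans (subsetIl _ _) nVL).
have sEG : (Q <*> D)%G \subset G.
  rewrite join_subG (subset_trans (subsetIl _ _) sAG).
  exact: subset_trans (subsetIr _ _) (pHall_sub sylS).
have [sQE sDE] : Q \subset (Q <*> D)%G /\ D \subset (Q <*> D)%G.
  by split; rewrite ?joing_subl ?joing_subr.
move: (Q <*> D)%G sQE sDE pE nVE sEG => E sQE sDE pE nVE sEG.
have pT : p.-group (V <*> E)%G.
  by rewrite /= norm_joinEr // pgroupM (pgroupS sVS pS).
(* By the modular law, S is contained in V (L :&: S). *)
have sST : S \subset V <*> E.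
  apply: subset_trans (_ : V * D \subset _).
    by rewrite /= group_modl // subsetI sSVL subxx.
  by rewrite norm_joinEr // mulgS.
have sTG : (V <*> E)%G \subset G.
  by rewrite join_subG (subset_trans sVS) ?(pHall_sub sylS).
have ET := sub_pHall sylS pT sST sTG.
apply/trivgP; rewrite -tiAS subsetI subsetIl -ET.
exact: subset_trans sQE (joing_subr _ _).
Qed.

(** * Subgroups generated by root subgroups of given height *)

Section RootGenerated.

Variables (gT : finGroupType) (G B N U : {group gT}) (p r : nat).
Variable s : 'I_r -> coset_of (B :&: N)%G.
Variable R : realType.
Hypothesis sBN : split_BN_pair G s p U.
Hypothesis commRel : commutator_relations s R U.
Variable J : {set 'I_r}.

Local Notation H := (B :&: N)%G.
Local Notation W := (N / H)%g.
Local Notation l := (weyl_length s).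
Local Notation we := (word_elt s).
Local Notation act := (@word_act _ _ _ _ s R).
Local Notation root := (@simple_root r R).
Local Notation w0 := (longest_elt s).
Local Notation BN := (split_BN sBN).
Local Notation sW := (mem_simple BN).
Local Notation X := (simple_root_subgroup s U).
Local Notation rsub := (@root_subgroup _ _ _ _ s R U).
Local Notation NJ := (parabolic_N s J).
Local Notation Jword := (all (mem J)).
Local Notation nUH := (split_H_norm sBN).

Definition height (v : 'rV[R]_r) : R := (\sum_(k | k \notin J) v 0 k)%R.

Lemma height_linear c u v : height (c *: u + v)%R = (c * height u + height v)%R.
Proof.
by rewrite /height mulr_sumr -big_split; apply: eq_bigr => k _; rewrite !mxE.
Qed.

Lemma height0 : height 0%R = 0%R.
Proof. by rewrite /height big1 // => k _; rewrite mxE. Qed.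

Lemma heightZ c u : height (c *: u)%R = (c * height u)%R.
Proof. by have := height_linear c u 0%R; rewrite height0 !addr0. Qed.

Lemma heightD u v : height (u + v)%R = (height u + height v)%R.
Proof. by have := height_linear 1%R u v; rewrite scale1r mul1r. Qed.

Lemma heightN u : height (- u)%R = (- height u)%R.
Proof. by rewrite -scaleN1r heightZ mulN1r. Qed.

Lemma height_root j : j \in J -> height (root j) = 0%R.
Proof.
move=> Jj; rewrite /height big1 // => k nJk; rewrite mxE.
by case: (eqVneq k j) nJk => [->|]; rewrite ?Jj ?andbF.
Qed.

(** A reflection with index in J changes a vector by a multiple of a simple root of height 0. *)
Lemma height_word_act t v : Jword t -> height (act t v) = height v.
Proof.
elim: t => [//|j t IH] /= /andP[Jj /IH <-].
by rewrite heightD heightN heightZ (height_root Jj) mulr0 oppr0 addr0.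
Qed.

Lemma parabolic_N_sub : NJ \subset N.
Proof.
apply: subset_trans (_ : coset H @*^-1 W \subset _); last first.
  by rewrite (quotientGK (BN_normal BN)).
rewrite morphpreS // gen_subG.
by apply/subsetP=> _ /imsetP[j _ ->]; apply: sW.
Qed.

Lemma parabolic_N_word n : n \in NJ ->
  exists2 t, Jword t & coset H n = we t.
Proof.
by case/morphpreP=> _ /gen_word[t Jt Et]; exists t.
Qed.

Lemma word_parabolic_N t n : Jword t -> n \in N -> coset H n = we t -> n \in NJ.
Proof.
move=> Jt Nn Dn; apply/morphpreP; split.
  exact: subsetP (norm_weyl BN) _ Nn.
rewrite /= Dn.
elim: t Jt {Dn} => [|j t IH] /=; first by rewrite word_elt_nil group1.
by case/andP=> Jj Jt; rewrite word_elt_cons groupM ?IH ?mem_gen ?imset_f.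
Qed.

Lemma repr_parabolic_N t : Jword t -> repr (we t) \in NJ.
Proof.
move=> Jt; apply: (word_parabolic_N Jt); rewrite ?coset_reprK //.
by rewrite (weyl_repr BN) ?(mem_word BN).
Qed.

Lemma parabolic_N_H : H \subset NJ.
Proof.
apply/subsetP=> h Hh; have [_ Nh] := setIP Hh.
by apply: (@word_parabolic_N [::]); rewrite // word_elt_nil coset_id.
Qed.

(** Conjugation [Y :^ n] is a right action and [word_act] a left one, whence the reversed word. *)
Lemma root_subgroup_conj t v (Y : {set gT}) n : rsub v Y -> n \in N ->
  coset H n = we t -> rsub (act (rev t) v) (Y :^ n).
Proof.
case=> u [i [m [Nm Dm -> ->]]] Nn Dn; exists (rev t ++ u), i, (n^-1 * m).
split; rewrite ?groupM ?groupV ?word_act_cat ?invMg ?invgK ?conjsgM //.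
rewrite word_elt_cat (word_elt_rev BN) -Dn -Dm.
by rewrite (coset_weylM BN) ?groupV // (coset_weylV BN).
Qed.

Lemma root_subgroup_simple t i : rsub (act (rev t) (root i)) (X i :^ repr (we t)).
Proof.
have Nt : repr (we t) \in N by rewrite (weyl_repr BN) ?(mem_word BN).
apply: root_subgroup_conj; rewrite ?coset_reprK //.
exists [::], i, 1; split; rewrite ?group1 ?invg1 ?conjsg1 ?word_elt_nil //.
exact: morph1 (coset_morphism H).
Qed.

Definition root_generated (P : 'rV[R]_r -> Prop) : {set gT} :=
  <<[set x | `[< exists v Y, [/\ rsub v Y, P v & x \in Y] >]]>>.

Canonical root_generated_group P := Eval hnf in [group of root_generated P].

Lemma sub_root_generated P v Y : rsub v Y -> P v -> Y \subset root_generated P.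
Proof.
move=> Yv Pv; apply/subsetP=> y Yy; apply: mem_gen; rewrite inE.
by apply/asboolP; exists v, Y.
Qed.

Lemma root_generated_sub P (A : {group gT}) :
  (forall v Y, rsub v Y -> P v -> Y \subset A) -> root_generated P \subset A.
Proof.
move=> sPA; rewrite gen_subG; apply/subsetP=> x; rewrite inE => /asboolP.
by case=> v [Y [Yv Pv]]; apply: subsetP (sPA v Y Yv Pv) x.
Qed.

Lemma root_generated_norm P g :
    (forall v Y, rsub v Y -> P v -> Y :^ g \subset root_generated P) ->
  g \in 'N(root_generated P).
Proof.
move=> sPg; rewrite inE sub_conjg.
apply: (@root_generated_sub _ (root_generated_group P :^ g^-1)%G) => v Y Yv Pv.
by rewrite /= -sub_conjg; apply: sPg Yv Pv.
Qed.

Local Notation gen := root_generated.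

(* The sign of e selects the unipotent radical or its opposite. *)
Lemma root_generated_norm_NJ e :
  NJ \subset 'N(gen (fun v => 0 < e * height v)%R).
Proof.
apply/subsetP=> n NJn; have Nn := subsetP parabolic_N_sub _ NJn.
have [t Jt Dn] := parabolic_N_word NJn.
apply: root_generated_norm => v Y Yv Pv.
apply: sub_root_generated (root_subgroup_conj Yv Nn Dn) _.
by rewrite height_word_act // all_rev.
Qed.

(** A positive combination a v + b u has height b times that of u, so commutators stay in the
    generated group; the heights also exclude v = u and v = - u. *)
Lemma root_generated_norm_height0 e v Y : rsub v Y -> height v = 0%R ->
  Y \subset 'N(gen (fun v => 0 < e * height v)%R).
Proof.
move=> Yv v0; apply/subsetP=> x Yx; apply: root_generated_norm => u Z Zu Pu.
set S := gen _; have sZS : Z \subset S by apply: sub_root_generated Zu Pu.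
have u0 : height u != 0%R by apply: contraTneq Pu => ->; rewrite mulr0 ltxx.
have nvu : v <> u by move=> E; rewrite -E v0 eqxx in u0.
have nvNu : v <> (- u)%R.
  by move=> E; case/eqP: u0; rewrite -[u]opprK -E heightN v0 oppr0.
have sRS : [~: Y, Z] \subset S.
  apply: subset_trans (commRel Yv Zu nvu nvNu) _; rewrite gen_subG.
  apply/subsetP=> z; rewrite inE => /asboolP[w [T [[a [b [_ b0 Ew]]] Tw Tz]]].
  apply: subsetP (sub_root_generated Tw _) z Tz.
  by rewrite Ew heightD !heightZ v0 mulr0 add0r mulrCA mulr_gt0.
apply/subsetP=> _ /imsetP[z Zz ->].
have -> : z ^ x = z * [~ x, z]^-1 by rewrite invg_comm commgEl mulKVg.
apply: groupM; first exact: subsetP sZS _ Zz.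
by rewrite groupV (subsetP sRS) ?mem_commg.
Qed.

Variable L : {group gT}.
Hypothesis defL : L = standard_Levi s U J :> {set gT}.

Lemma Levi_H : H \subset L.
Proof. by rewrite defL; apply/subsetP=> x Hx; rewrite mem_gen // inE Hx. Qed.

Lemma Levi_root t j : Jword t -> j \in J -> X j :^ repr (we t) \subset L.
Proof.
move=> Jt Jj; rewrite defL; apply/subsetP=> x Xx; apply: mem_gen.
rewrite inE; apply/orP; right; apply/bigcupP; exists j => //.
by apply/bigcupP; exists (repr (we t)); first exact: repr_parabolic_N.
Qed.

Lemma Levi_norm e : L \subset 'N(gen (fun v => 0 < e * height v)%R).
Proof.
rewrite defL gen_subG subUset; apply/andP; split.
  exact: subset_trans parabolic_N_H (root_generated_norm_NJ e).
apply/bigcupsP=> j Jj; apply/bigcupsP=> n NJn.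
have Nn := subsetP parabolic_N_sub _ NJn; have [t Jt Dn] := parabolic_N_word NJn.
have Xj : rsub (root j) (X j).
  have := root_subgroup_simple [::] j.
  by rewrite /= word_elt_nil (conj_weyl1 sBN) // (root_H_norm sBN).
apply: root_generated_norm_height0 (root_subgroup_conj Xj Nn Dn) _.
by rewrite height_word_act ?all_rev // height_root.
Qed.

Lemma nonneg_height v : nonneg v -> (0 <= height v)%R.
Proof. by move=> v0; apply: sumr_ge0 => k _; apply: v0. Qed.

Lemma root_subgroup_weyl v Y : rsub v Y -> exists t i,
  v = act t (root i) /\ Y = X i :^ repr (we t)^-1.
Proof.
case=> t [i [n [Nn Dn -> ->]]]; exists t, i; split=> //.
by rewrite -Dn -(coset_weylV BN) // (conj_weyl sBN) ?groupV // (root_H_norm sBN).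
Qed.

(** By [word_act_nonpos], positive height forces [s i] to lengthen the word on the right; [root_up]
    applies to the inverse. *)
Lemma root_subgroup_pos v Y : rsub v Y -> (0 < height v)%R -> Y \subset U.
Proof.
case/root_subgroup_weyl=> t [i [-> ->]] v0; have Wt := mem_word BN t.
have Wt' : (we t)^-1 \in W by rewrite groupV.
apply: (root_up sBN Wt'); rewrite -(len_simpler BN) // (len_inv BN) //.
apply: contraTT v0; rewrite -(len_simplerP BN) // => down.
have := nonneg_height (word_act_nonpos BN R down).
by rewrite heightN oppr_ge0 leNgt.
Qed.

Lemma root_subgroup_neg v Y : rsub v Y -> (height v < 0)%R ->
  Y \subset U :^ repr w0.
Proof.
case/root_subgroup_weyl=> t [i [-> ->]] v0; have Wt := mem_word BN t.
have Wt' : (we t)^-1 \in W by rewrite groupV.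
apply: (root_down sBN Wt'); rewrite -(len_simpler BN) // (len_inv BN) //.
rewrite (len_simplerP BN) //; apply: contraTN v0 => up.
by have := nonneg_height (word_act_nonneg BN R up); rewrite leNgt.
Qed.

Lemma longest_parabolic_word : exists t, [/\ Jword t, reduced s t
  & forall j, j \in J -> (l (we t * s j) < l (we t))%N].
Proof.
pose q k := `[< exists t, [/\ Jword t, reduced s t & size t = k] >].
have q0 : exists k, q k.
  by exists 0%N; apply/asboolP; exists [::]; rewrite /reduced word_elt_nil len1.
have qle k : q k -> (k <= l w0)%N.
  by move/asboolP=> [t [_ /eqP <- <-]]; rewrite longest_max ?(mem_word BN).
case: (ex_maxnP q0 qle) => k /asboolP[t [Jt rt <-{k}]] maxt.
exists t; split=> // j Jj; have Wt := mem_word BN t.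
rewrite (len_simplerP BN) //; apply/negP=> up.
have /maxt : q (size t).+1; last by rewrite ltnn.
apply/asboolP; exists (rcons t j); rewrite all_rcons size_rcons /= Jj Jt.
split=> //; rewrite /reduced word_elt_rcons (len_simpler_up BN) //.
by rewrite (eqP rt) size_rcons.
Qed.

Lemma reduced_suffix_root i t : reduced s (i :: t) ->
  nonneg (act (rev t) (root i)).
Proof.
move=> red; apply: (word_act_nonneg BN); have Wt := mem_word BN t.
rewrite (word_elt_rev BN) (len_simpler BN) ?groupV // (len_inv BN) // invgK.
have /andP[_ /eqP->] := @reduced_cat _ _ _ _ _ _ BN [:: i] t red.
by rewrite -word_elt_cons (eqP red).
Qed.

(* Otherwise the root v has support in J, so that t, being longest in W_J, makes
   it negative; but t v = z^-1 (root i) is positive. *)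
Lemma height_suffix_root t i z : Jword t ->
    (forall j, j \in J -> (l (we t * s j) < l (we t))%N) ->
    reduced s (i :: z ++ t) ->
  (0 < height (act (rev (z ++ t)) (root i)))%R.
Proof.
move=> Jt maxt red; have pos := reduced_suffix_root red.
have /andP[red' _] := @reduced_cat _ _ _ _ _ _ BN (i :: z) t red.
have posz := reduced_suffix_root red'.
set v := act _ _ in pos *; set d := act _ _ in posz.
have Ed : act t v = d.
  by rewrite /v rev_cat word_act_cat (word_actKrev BN).
rewrite lt_def nonneg_height // andbT; apply/eqP=> v0.
have vk k : k \notin J -> v 0%R k = 0%R.
  move=> nJk; have /eqP := v0.
  rewrite psumr_eq0 => [/allP/(_ k)|? _]; last exact: pos.
  by rewrite mem_index_enum nJk => /(_ isT)/eqP.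
have Dv : v = (\sum_(k in J) v 0%R k *: root k)%R.
  rewrite {1}[v]row_sum_delta (bigID (mem J)) /=.
  rewrite [X in (_ + X)%R]big1 ?addr0 // => k nJk.
  by rewrite vk // scale0r.
have dneg : nonneg (- d)%R.
  rewrite -Ed Dv word_act_sum -sumrN => k; rewrite summxE; apply: sumr_ge0 => j Jj.
  rewrite word_actZ -scalerN mxE mulr_ge0 //.
  exact: (word_act_nonpos BN R (maxt j Jj)).
have d0 : d = 0%R.
  apply/rowP=> k; rewrite [RHS]mxE; apply/eqP; rewrite eq_le posz andbT.
  by have := dneg k; rewrite mxE oppr_ge0.
have: root i = 0%R by rewrite -(word_actKrev BN z (root i)) -/d d0 word_act0.
move/rowP/(_ i)/eqP; rewrite !mxE !eqxx /=; apply/negP; exact: oner_neq0.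
Qed.

(** Each use of [U_chain] strips the first letter, so A absorbs the root subgroups met between z ++
    t and t one by one. *)
Lemma U_chain_word (A : {group gT}) z t :
    (forall z1 i z2, z = z1 ++ i :: z2 -> X i :^ repr (we (z2 ++ t)) \subset A) ->
    reduced s (z ++ t) -> U :&: U :^ repr (we (z ++ t)) \subset A ->
  U :&: U :^ repr (we t) \subset A.
Proof.
elim: z => [//|i z IH] sXA red sUA.
have /andP[_ redz] := @reduced_cat _ _ _ _ _ _ BN [:: i] (z ++ t) red.
apply: IH => // [z1 j z2 Ez|]; first by apply: (sXA (i :: z1)); rewrite Ez.
apply: subset_trans (U_chain sBN (i := i) (mem_word BN _) _) _.
  by rewrite -word_elt_cons (eqP red) (eqP redz).
rewrite -word_elt_cons mul_subG //; exact: (sXA [::]).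
Qed.

(** Here the bound is carried the other way, from t up to z ++ t. *)
Lemma U_chain_opp_word (A : {group gT}) z t :
    (forall z1 i z2, z = z1 ++ i :: z2 ->
       X i :^ repr (we (i :: z2 ++ t)) \subset A) ->
    reduced s (z ++ t) -> U :^ repr w0 :&: U :^ repr (we t) \subset A ->
  U :^ repr w0 :&: U :^ repr (we (z ++ t)) \subset A.
Proof.
elim: z => [//|i z IH] sXA red sUA.
have /andP[_ redz] := @reduced_cat _ _ _ _ _ _ BN [:: i] (z ++ t) red.
have Ew : s i * we (i :: z ++ t) = we (z ++ t).
  by rewrite word_elt_cons (simpleK BN).
apply: subset_trans (U_chain_opp sBN (i := i) (mem_word BN _) _) _.
  by rewrite Ew (eqP red) (eqP redz).
rewrite Ew mul_subG //; first exact: (sXA [::]).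
by apply: IH => // z1 j z2 Ez; apply: (sXA (i :: z1)); rewrite Ez.
Qed.

Local Notation UJ := (root_generated_group (fun v => 0 < 1 * height v)%R).
Local Notation VJ := (root_generated_group (fun v => 0 < -1 * height v)%R).
Local Notation Um := (U :^ repr w0)%G.

Lemma unipotent_sub : UJ \subset U.
Proof.
apply: root_generated_sub => v Y Yv; rewrite mul1r; exact: root_subgroup_pos.
Qed.

Lemma opp_unipotent_sub : VJ \subset Um.
Proof.
apply: root_generated_sub => v Y Yv; rewrite mulN1r oppr_gt0.
exact: root_subgroup_neg.
Qed.

(** The first claim, with n a representative of the longest word in J, is for [pcore_parabolic],
    where 'O_p(P) lies in both U and U^n. *)
Lemma Levi_factor : [/\ exists2 n, n \in NJ & U :&: U :^ n \subset UJ,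
  U \subset UJ * L & Um \subset VJ * L].
Proof.
have [t [Jt rt maxt]] := longest_parabolic_word.
have [z Ez Dz] := longest_word BN (eqP rt).
have red : reduced s (z ++ t) by rewrite /reduced Ez Dz.
have suffix z1 i z2 : z = z1 ++ i :: z2 -> reduced s (i :: z2 ++ t).
  by move=> E; move: red; rewrite E -catA => /(reduced_cat BN)/andP[].
have htz z1 i z2 : z = z1 ++ i :: z2 -> (0 < height (act (rev (z2 ++ t)) (root i)))%R.
  by move/suffix; apply: height_suffix_root.
have Jt_suffix t1 i t2 : t = t1 ++ i :: t2 -> i \in J /\ Jword t2.
  by move=> E; move: Jt; rewrite E all_cat /= => /and3P[].
have sUt : U :&: U :^ repr (we t) \subset UJ.
  apply: (U_chain_word (z := z)) => //; last first.
    by rewrite Ez (tiU_longest sBN) sub1G.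
  move=> z1 i z2 E; apply: sub_root_generated (root_subgroup_simple _ _) _.
  by rewrite mul1r; apply: htz E.
(* The opposite chain with the letters of t only, starting from [Um :&: U], which is trivial. *)
have sUmt : Um :&: U :^ repr (we t) \subset L.
  have := @U_chain_opp_word L t [::]; rewrite cats0; apply=> //.
    move=> t1 i t2 /Jt_suffix[Ji Jt2]; rewrite cats0.
    by apply: Levi_root; rewrite //= Ji.
  by rewrite word_elt_nil (conj_weyl1 sBN nUH) setIC (tiU_longest sBN) sub1G.
have [sUJ sLJ] := (joing_subl UJ L, joing_subr UJ L).
have [sVJ sLJ'] := (joing_subl VJ L, joing_subr VJ L).
split.
- by exists (repr (we t)); first exact: repr_parabolic_N.
- rewrite -norm_joinEr ?Levi_norm // -[gval U]setIid.
  rewrite -{2}(conj_weyl1 sBN nUH) -(word_elt_nil s).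
  apply: (U_chain_word (A := (UJ <*> L)%G) (z := t)).
  + move=> t1 i t2 /Jt_suffix[Ji Jt2]; rewrite cats0; apply: subset_trans sLJ.
    exact: Levi_root.
  + by rewrite cats0.
  by rewrite cats0; apply: subset_trans sUJ.
(* [Um] is its own intersection with U^w0, and w0 is spelled by z ++ t. *)
rewrite -norm_joinEr ?Levi_norm // -[gval Um]setIid /= -{2}Ez.
apply: (U_chain_opp_word (A := (VJ <*> L)%G)) => //; last first.
  exact: subset_trans sLJ'.
move=> z1 i z2 E; apply: subset_trans sVJ.
apply: sub_root_generated (root_subgroup_simple _ _) _.
(* The leading letter i of the suffix reverses the sign of the root. *)
rewrite rev_cons word_act_rcons (refl_self BN) word_actN heightN mulrNN mul1r.
exact: htz E.
Qed.

Lemma opp_unipotent_Sylow : p.-Sylow(G) Um.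
Proof.
have Nw : repr w0 \in N by rewrite (weyl_repr BN) ?longest_mem.
by rewrite pHallJ ?(split_U_Sylow sBN) // (subsetP (split_N_sub sBN)).
Qed.

Lemma unipotent_p : p.-group UJ.
Proof. exact: pgroupS unipotent_sub (split_U sBN). Qed.

Lemma opp_unipotent_p : p.-group VJ.
Proof. by apply: pgroupS opp_unipotent_sub _; rewrite pgroupJ (split_U sBN). Qed.

Lemma unipotent_subG : UJ \subset G.
Proof. exact: subset_trans unipotent_sub (split_U_sub sBN). Qed.

Lemma opp_unipotent_subG : VJ \subset G.
Proof. exact: subset_trans opp_unipotent_sub (pHall_sub opp_unipotent_Sylow). Qed.

Lemma unipotent_tiN : UJ :&: 'N(VJ) = 1.
Proof.
have [_ _ sUm] := Levi_factor.
apply: (tiI_norm_Sylow opp_unipotent_Sylow) sUm _ => //.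
- exact: unipotent_p.
- exact: unipotent_subG.
- exact: Levi_norm.
- exact: Levi_norm.
- exact: opp_unipotent_sub.
by apply/trivgP; rewrite -(tiU_longest sBN) setSI // unipotent_sub.
Qed.

Lemma opp_unipotent_tiN : VJ :&: 'N(UJ) = 1.
Proof.
have [_ sU _] := Levi_factor.
apply: (tiI_norm_Sylow (split_U_Sylow sBN)) sU _ => //.
- exact: opp_unipotent_p.
- exact: opp_unipotent_subG.
- exact: Levi_norm.
- exact: Levi_norm.
- exact: unipotent_sub.
apply/trivgP; rewrite -(tiU_longest sBN) subsetI subsetIr.
exact: subset_trans (subsetIl _ _) opp_unipotent_sub.
Qed.

(** For n over s_j, some x in X_j^n is outside B, since X_j^n lies in U^w0, which meets U trivially.
    This x is in L and in B n B, so n is in [UJ * L]. In n = v y, both n and y normalise VJ, hence v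
    = 1 by [unipotent_tiN]. *)
Lemma parabolic_N_Levi : NJ \subset L.
Proof.
have [_ sU _] := Levi_factor; set K := UJ * L in sU.
have gK : group_set K by rewrite /K -norm_joinEr ?Levi_norm ?groupP.
have sLK : L \subset K by apply: mulG_subr.
have sBK : B \subset K.
  have [_ <- _ _] := sdprodP (split_B sBN).
  by rewrite -[K]/(gval (Group gK)) mul_subG //; apply: subset_trans Levi_H sLK.
have simple n j : j \in J -> n \in NJ -> coset H n = s j -> n \in L.
  move=> Jj NJn Dn; have Nn := subsetP parabolic_N_sub _ NJn.
  have Ej : X j :^ n = X j :^ repr (s j).
    by rewrite -Dn (conj_weyl sBN) ?(root_H_norm sBN).
  have sXU : X j :^ n \subset U :^ repr w0.
    rewrite Ej (root_down sBN) ?sW // (simple_mulK BN) len1 lt0n.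
    by rewrite (len_eq0 BN) ?sW ?(simple_neq1 BN).
  have /subsetPn[x Xx nBx] : ~~ (X j :^ n \subset B).
    apply: contra (simple_root_subgroup_neq1 sBN j) => sXB.
    apply/eqP/(@conjsg_inj _ n); rewrite conjs1g; apply/trivgP.
    rewrite -(tiU_longest sBN) subsetI; apply/andP; split.
      apply/subsetP=> x Xx; apply: (mem_U_conj sBN (subsetP sXB x Xx) (g := n)).
      by apply: subsetP Xx; rewrite conjSg root_subU.
    exact: sXU.
  have Lx : x \in L.
    apply: subsetP Xx; rewrite Ej -word_elt1; apply: Levi_root => //=.
    by rewrite Jj.
  have Dx : x \in bruhat_cell (s j).
    have Bx : x \in B :^ repr (s j).
      apply: subsetP Xx; rewrite Ej conjSg; apply: subset_trans (root_subU _ _ _) _.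
      exact: normal_sub (split_U_normal sBN).
    by have := conj_simple_cell sBN Bx; rewrite (negPf nBx).
  move: Dx; rewrite -Dn => /(bruhat_cellP BN)[] // b [b' [Bb Bb' Ex]].
  have : n \in Group gK.
    have -> : n = b^-1 * x * b'^-1 by rewrite Ex !mulgA mulVg mul1g mulgK.
    have [Kb Kb'] : b \in Group gK /\ b' \in Group gK by split; apply: subsetP sBK _ _.
    have Kx : x \in Group gK by apply: subsetP sLK _ _.
    by rewrite !groupM ?groupV.
  case/mulsgP=> v y UJv Ly Env; suff -> : n = y by [].
  suff v1 : v = 1 by rewrite Env v1 mul1g.
  apply/set1gP; rewrite -unipotent_tiN; apply/setIP; split=> //.
  rewrite -(groupMr _ (subsetP (Levi_norm (-1)) _ Ly)) -Env.
  exact: subsetP (root_generated_norm_NJ (-1)) _ NJn.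
apply/subsetP=> n NJn; have Nn := subsetP parabolic_N_sub _ NJn.
have [t Jt Dn] := parabolic_N_word NJn.
elim: t n Jt NJn Nn Dn => [|j t IH] n.
  rewrite word_elt_nil => _ _ Nn /coset_idr Hn; apply: subsetP Levi_H _ _.
  by apply: Hn; rewrite (subsetP (norm_weyl BN)).
case/andP=> Jj Jt NJn Nn; rewrite word_elt_cons => Dn.
have Jj1 : Jword [:: j] by apply/andP.
have NJm := repr_parabolic_N Jj1; rewrite word_elt1 in NJm.
have Nm := subsetP parabolic_N_sub _ NJm.
rewrite -(mulKVg (repr (s j)) n); apply: groupM.
  exact: simple Jj NJm (coset_reprK _).
apply: IH => //; rewrite ?groupM ?groupV //.
by rewrite (coset_weylM BN) ?groupV // (coset_weylV BN) // coset_reprK Dn mulKg.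
Qed.

Lemma Levi_cap_unipotent : UJ :&: L = 1.
Proof.
by apply/trivgP; rewrite -unipotent_tiN setIS // Levi_norm.
Qed.

Lemma Levi_cap_opp_unipotent : VJ :&: L = 1.
Proof.
by apply/trivgP; rewrite -opp_unipotent_tiN setIS // Levi_norm.
Qed.

Variable P : {group gT}.
Hypothesis defP : P = standard_parabolic s J :> {set gT}.

Lemma parabolic_B : B \subset P.
Proof.
apply/subsetP=> b Bb; rewrite defP -(mulg1 b) mem_mulg // -(mulg1 b).
by rewrite mem_mulg ?group1.
Qed.

Lemma parabolic_N_parabolic : NJ \subset P.
Proof.
apply/subsetP=> n NJn; rewrite defP -(mulg1 n) mem_mulg // -(mul1g n).
by rewrite mem_mulg.
Qed.

Lemma parabolic_sdprod : UJ ><| L = P.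
Proof.
have [_ sU _] := Levi_factor.
have sUB := normal_sub (split_U_normal sBN).
rewrite sdprodE ?Levi_norm ?Levi_cap_unipotent //.
apply/eqP; rewrite eqEsubset -norm_joinEr ?Levi_norm // in sU *.
apply/andP; split.
  rewrite join_subG (subset_trans unipotent_sub (subset_trans sUB parabolic_B)).
  rewrite defL gen_subG subUset (subset_trans parabolic_N_H parabolic_N_parabolic).
  apply/bigcupsP=> j Jj; apply/bigcupsP=> n NJn.
  have Pn := subsetP parabolic_N_parabolic _ NJn.
  rewrite -(conjGid Pn) conjSg (subset_trans (root_subU _ _ _)) //.
  exact: subset_trans sUB parabolic_B.
have sLK := joing_subr UJ L.
have sBK : B \subset UJ <*> L.
  have [_ <- _ _] := sdprodP (split_B sBN).
  by rewrite mul_subG // (subset_trans Levi_H).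
have sNK : NJ \subset UJ <*> L by apply: subset_trans parabolic_N_Levi _.
by rewrite defP mul_subG ?mul_subG.
Qed.

Lemma parabolic_sub : P \subset G.
Proof.
rewrite defP !mul_subG ?(split_B_sub sBN) //.
exact: subset_trans parabolic_N_sub (split_N_sub sBN).
Qed.

Lemma split_U_Sylow_parabolic : p.-Sylow(P) U.
Proof.
apply: pHall_subl (split_U_Sylow sBN); last exact: parabolic_sub.
exact: subset_trans (normal_sub (split_U_normal sBN)) parabolic_B.
Qed.

(** A normal p-subgroup lies in every Sylow p-subgroup of P, here U and U^n, whose intersection is
    in UJ by [Levi_factor]. *)
Lemma pcore_parabolic : 'O_p(P) = UJ.
Proof.
have [nUP _ _ _ _] := sdprod_context parabolic_sdprod.
apply/eqP; rewrite eqEsubset andbC pcore_max ?unipotent_p //=.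
have [[n NJn sUUn] _ _] := Levi_factor; apply: subset_trans sUUn.
have Pn := subsetP parabolic_N_parabolic _ NJn.
rewrite subsetI (pcore_sub_Hall split_U_Sylow_parabolic).
rewrite -(normP (subsetP (normal_norm (pcore_normal p P)) _ Pn)) conjSg.
exact: pcore_sub_Hall split_U_Sylow_parabolic.
Qed.

(** P and VJ L have Sylow p-subgroups U and [Um] of equal order; cancel the p-part of the order of
    L. *)
Lemma opp_unipotent_card : #|VJ| = #|UJ|.
Proof.
have [_ _ sUm] := Levi_factor.
have Em : VJ ><| L = (VJ <*> L)%G.
  by rewrite sdprodEY ?Levi_norm ?Levi_cap_opp_unipotent.
have sQG : (VJ <*> L)%G \subset G.
  rewrite join_subG opp_unipotent_subG; apply: subset_trans parabolic_sub.
  by have [_ ->] := sdprod_context parabolic_sdprod.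
have sylm : p.-Sylow((VJ <*> L)%G) Um.
  by apply: pHall_subl (opp_unipotent_Sylow); rewrite //= norm_joinEr ?Levi_norm.
have := card_Hall sylm; have := card_Hall split_U_Sylow_parabolic.
rewrite -(sdprod_card parabolic_sdprod) -(sdprod_card Em) /= cardJg => ->.
rewrite !partnM ?cardG_gt0 // (part_pnat_id unipotent_p) (part_pnat_id opp_unipotent_p).
by move/eqP; rewrite eqn_pmul2r ?part_gt0 // => /eqP.
Qed.

Lemma Levi_decomposition : 'O_p(P) ><| L = P /\
  exists V : {group gT}, [/\ V \subset G, L \subset 'N(V), P :&: V = 1
                          & #|V| = #|'O_p(P)|].
Proof.
rewrite pcore_parabolic; split; first exact: parabolic_sdprod.
exists VJ; rewrite opp_unipotent_subG opp_unipotent_card Levi_norm; split=> //.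
have [nUP _ _ _ _] := sdprod_context parabolic_sdprod.
apply/trivgP; rewrite -opp_unipotent_tiN subsetI subsetIr.
exact: subset_trans (subsetIl _ _) (normal_norm nUP).
Qed.

End RootGenerated.

Theorem proposition7p1
  (gT : finGroupType) (G B N U : {group gT}) (p r : nat)
  (s : 'I_r -> coset_of (B :&: N)%G) (R : realType)
  (splitBN : split_BN_pair G s p U)
  (commRel : commutator_relations s R U)
  (K : closedFieldType) (charK : p \notin [pchar K]%R)
  (n : nat) (M : mx_representation K G n) (irrM : mx_irreducible M)
  (P : {group gT}) (sPG : P \subset G) (parP : is_parabolic s P)
  (imprM : imprimitive_with_block_stabilizer sPG M)
  (L : {group gT}) (leviL : Levi_complement s U P L) :
  exists (defP : ('O_p(P) ><| L = P)%g)
         (m : nat) (M1 : mx_representation K L m),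
    mx_rsim M (HC_induction sPG defP M1).
Proof.
have [J [g [Ng DP DL]]] := leviL; have [_ [m [rP simM]]] := imprM.
have Gg : g \in G := subsetP (split_N_sub splitBN) g Ng.
(* Conjugation by g^-1 reduces to the standard parabolic and Levi subgroups. *)
have DP' : (P :^ g^-1)%G = standard_parabolic s J :> {set gT}.
  by rewrite /= DP conjsgK.
have DL' : (L :^ g^-1)%G = standard_Levi s U J :> {set gT}.
  by rewrite /= DL conjsgK.
have [defP' [V' [sV'G nV'L tiPV' cardV']]] :=
  Levi_decomposition splitBN commRel DL' DP'.
have defP : 'O_p(P) ><| L = P.
  by apply: (@conjsg_inj _ g^-1); rewrite sdprodJ -pcoreJ.
pose V := (V' :^ g)%G.
have nVL : L \subset 'N(V).
  by rewrite normJ -sub_conjgV.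
have tiPV : P :&: V = 1.
  by apply: (@conjsg_inj _ g^-1); rewrite conjIg conjsgK conjs1g.
have [_ defPU nUL tiUL] := sdprodP defP.
have sLP : L \subset P by rewrite -defPU mulG_subr.
have defQ : V ><| L = (V <*> L)%G.
  rewrite sdprodEY //; apply/trivgP; rewrite -tiPV subsetI subsetIl andbT.
  exact: subset_trans (subsetIr _ _) sLP.
have sQG : (V <*> L)%G \subset G.
  rewrite join_subG (subset_trans sLP) // andbT.
  by rewrite -(conjGid Gg) conjSg.
have cardPQ : #|P| = #|(V <*> L)%G|.
  by rewrite -(sdprod_card defP) -(sdprod_card defQ) cardJg cardV' pcoreJ cardJg.
have sLQ : L \subset (V <*> L)%G := joing_subr V L.
(* The condition for the return from Q to P, with 'O_p(P) in the role of V. *)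
have tiQU : (V <*> L)%G :&: 'O_p(P) = 1.
  apply/trivgP/subsetP=> x /setIP[].
  rewrite -{1}(sdprodW defQ) => /mulsgP[v l Vv Ll ->] Ux.
  have Pv : v \in P.
    by rewrite -(groupMr v (subsetP sLP l Ll)) (subsetP (pcore_sub p P)).
  have v1 : v = 1 by apply/set1gP; rewrite -tiPV inE Pv.
  by rewrite v1 mul1g in Ux *; rewrite -tiUL inE Ux.
exists defP, m.
pose rQ := inflation defQ (subg_repr rP sLP).
(* The second use of [Ind_opposite] starts from [rQ], so it returns the inflation of the restriction
   of [rQ] to L. *)
exists (subg_repr rQ sLQ).
have simQ := Ind_opposite sQG sLP defQ tiPV cardPQ irrM simM.
exact: (Ind_opposite sPG sLQ defP tiQU (esym cardPQ) irrM simQ).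
Qed.
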